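(* Let $n\ge1$ and $0<s<n$. The space $H^s_{\mathcal D}(\mathbb R^n)$ is an algebra, i.e. $fg\in H^s_{\mathcal D}(\mathbb R^n)$ for all $f,g\in H^s_{\mathcal D}(\mathbb R^n)$ (pointwise multiplication), if and only if $s>\frac n2$.
   Context: $\mathbb R^n$ carries Lebesgue measure, denoted $|\cdot|$; functions are real-valued. $\mathcal D$ is the standard dyadic grid: all cubes $Q=I_1\times\dots\times I_n$ where $I_1,\dots,I_n$ are dyadic intervals $[2^k m,2^k(m+1))$, $m\in\mathbb Z$, of the same length $2^k$, $k\in\mathbb Z$. For a dyadic interval $I$ with left half $I_-$ and right half $I_+$ put $h_I^0=|I|^{-1/2}(\mathbf 1_{I_+}-\mathbf 1_{I_-})$ and $h_I^1=|I|^{-1/2}\mathbf 1_I$. For $Q=I_1\times\dots\times I_n\in\mathcal D$ and $\varepsilon\in\{0,1\}^n\setminus\{(1,\dots,1)\}$ put $h_Q^\varepsilon(x)=\prod_{i=1}^n h_{I_i}^{\varepsilon_i}(x_i)$; these Haar functions form an orthonormal basis of $L^2(\mathbb R^n)$. ''$\varepsilon\not\equiv 1$'' means $\varepsilon\neq(1,\dots,1)$. Write $(f,g)=\int_{\mathbb R^n}fg\,dx$. For $s>0$ the dyadic fractional derivative is $D^s_{\mathcal D}f=\sum_{Q\in\mathcal D,\ \varepsilon\not\equiv1}|Q|^{-s/n}(f,h_Q^\varepsilon)h_Q^\varepsilon$, and $H^s_{\mathcal D}(\mathbb R^n)=\{f\in L^2(\mathbb R^n): D^s_{\mathcal D}f\in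 L^2(\mathbb R^n)\}$, where $D^s_{\mathcal D}f\in L^2$ means $\sum_{Q\in\mathcal D,\ \varepsilon\not\equiv1}|Q|^{-2s/n}|(f,h_Q^\varepsilon)|^2<\infty$. *)

(* Defs.v *)
From HB Require Import structures.
From mathcomp Require Import all_boot all_order all_algebra.
From mathcomp Require Import all_classical all_reals all_analysis.

Set Implicit Arguments.
Unset Strict Implicit.
Unset Printing Implicit Defensive.

Import Order.TTheory GRing.Theory Num.Theory.
Import numFieldNormedType.Exports.

Local Open Scope classical_set_scope.
Local Open Scope ring_scope.

(* R^n is the type n.-tuple R with the product of the Borel sigma-algebras.
   Its Lebesgue measure is the n-fold product of the library's one-dimensional
   Lebesgue measure: R^0 carries the unit mass at its only point, and the
   measure on R^(n+1) is the image of (lebesgue_measure \x measure on R^n)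
   under (t, x) |-> t :: x. *)
Section lebesgue_tuple.
Context {R : realType}.

Section step.
Context {n : nat}.
Variable mu : {sigma_finite_measure set (n.-tuple R) -> \bar R}.

Definition tcons (z : measurableTypeR R * n.-tuple R) : n.+1.-tuple R :=
  [tuple of z.1 :: z.2].

Lemma measurable_tcons : measurable_fun setT tcons.
Proof.
apply: (@measurable_cons _ _ (measurableTypeR R * n.-tuple R)%type R
  (fun z => z.1 : R) n (fun z => z.2)).
  exact: measurable_fst.
exact: measurable_snd.
Qed.

Definition lebesgue_cons : set (n.+1.-tuple R) -> \bar R :=
  pushforward (@lebesgue_measure R \x mu)%E tcons.

Let lebesgue_cons0 : lebesgue_cons set0 = 0%E.
Proof. by rewrite /lebesgue_cons /pushforward preimage_set0 measure0. Qed.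

Let lebesgue_cons_ge0 A : (0 <= lebesgue_cons A)%E.
Proof. by rewrite /lebesgue_cons /pushforward; exact: measure_ge0. Qed.

Let lebesgue_cons_sigma_additive : semi_sigma_additive lebesgue_cons.
Proof.
move=> F mF tF mUF; rewrite /lebesgue_cons /pushforward preimage_bigcup.
apply: measure_semi_sigma_additive.
- by move=> i; rewrite -[X in measurable X]setTI; exact: measurable_tcons.
- apply/trivIsetP => /= i j _ _ ij; rewrite -preimage_setI.
  by move/trivIsetP : tF => /(_ _ _ _ _ ij) ->//; rewrite preimage_set0.
- by rewrite -preimage_bigcup -[X in measurable X]setTI; exact: measurable_tcons.
Qed.

HB.instance Definition _ := isMeasure.Build _ _ _ lebesgue_cons
  lebesgue_cons0 lebesgue_cons_ge0 lebesgue_cons_sigma_additive.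

Lemma lebesgue_consX (A : set R) (B : set (n.-tuple R)) :
  measurable A -> measurable B ->
  lebesgue_cons [set x | A (thead x) /\ B [tuple of behead x]] =
  (lebesgue_measure A * mu B)%E.
Proof.
move=> mA mB; rewrite /lebesgue_cons /pushforward.
rewrite -product_measure1E//; congr (_ _).
apply/seteqP; split => -[t x] /=; rewrite theadE.
  move=> [At Bx]; split => //=; congr (B _) : Bx; exact/val_inj.
move=> [/= At Bx]; split => //; congr (B _) : Bx; exact/val_inj.
Qed.

Let lebesgue_cons_sigma_finite : sigma_finite setT lebesgue_cons.
Proof.
have /sigma_finiteP[F [TF ndF Foo]] :=
  sigma_finiteT (@lebesgue_measure R : {sigma_finite_measure set _ -> \bar R}).
have /sigma_finiteP[G [TG ndG Goo]] := sigma_finiteT mu.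
exists (fun k => [set x : n.+1.-tuple R |
    F k (thead x) /\ G k [tuple of behead x]]).
  apply/seteqP; split => // x _.
  have [i _ Fi] : (\bigcup_i F i) (thead x) by rewrite -TF.
  have [j _ Gj] : (\bigcup_i G i) [tuple of behead x] by rewrite -TG.
  exists (maxn i j) => //; split.
    by move: Fi; exact/subsetPset/ndF/leq_maxl.
  by move: Gj; exact/subsetPset/ndG/leq_maxr.
move=> k; have [mF Fk] := Foo k; have [mG Gk] := Goo k; split.
  apply: measurableI.
    rewrite -[X in measurable X]setTI.
    exact: (@measurable_tnth _ R n.+1 ord0 measurableT _ mF).
  rewrite -[X in measurable X]setTI.
  exact: (@measurable_behead _ R n measurableT _ mG).
rewrite lebesgue_consX// lte_mul_pinfty//.
by rewrite ge0_fin_numE.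
Qed.

HB.instance Definition _ := Measure_isSigmaFinite.Build _ _ _ lebesgue_cons
  lebesgue_cons_sigma_finite.

End step.

Fixpoint lebesgue_tuple (n : nat) :
    {sigma_finite_measure set (n.-tuple R) -> \bar R} :=
  match n with
  | 0 => \d_([tuple] : 0.-tuple R)
  | m.+1 => lebesgue_cons (lebesgue_tuple m)
  end.

Lemma lebesgue_tuple_box n (A : 'I_n -> set R) :
  (forall i, measurable (A i)) ->
  lebesgue_tuple n [set x | forall i, A i (tnth x i)] =
  (\prod_(i < n) lebesgue_measure (A i))%E.
Proof.
elim: n A => [|n IH] A mA.
  rewrite big_ord0 /= diracE mem_set// => -[].
  by [].
rewrite big_ord_recl -IH; last by move=> i; exact: mA.
rewrite -lebesgue_consX //=.
  congr (lebesgue_cons _ _); apply/seteqP; split => x /=.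
    move=> Ax; split; first exact: Ax.
    by move=> i; have := Ax (lift ord0 i); rewrite {1}(tuple_eta x) tnthS.
  move=> [A0 Ax] i; case: (unliftP ord0 i) => [j|] ->; last exact: A0.
  by rewrite (tuple_eta x) tnthS.
rewrite (_ : mkset _ =
    \bigcap_(i in [set: 'I_n]) (setT `&` (fun x : n.-tuple R => tnth x i) @^-1`
      A (lift ord0 i))).
  apply: fin_bigcap_measurable => // i _.
  exact: (@measurable_tnth _ R n i measurableT).
by apply/seteqP; split => x /= Ax i; [split|have [] := Ax i I].
Qed.

End lebesgue_tuple.

Section dyadic.
Context {R : realType}.

Definition dyadic_itv (k m : int) : set R :=
  [set` `[2 ^ k * m%:~R, 2 ^ k * (m + 1)%:~R[%R].

Definition itv_length (k m : int) : R :=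
  fine (lebesgue_measure (dyadic_itv k m)).

(* The left and right halves of dyadic_itv k m are the dyadic intervals
   (k - 1, 2m) and (k - 1, 2m + 1); e = false is h^0 and e = true is h^1. *)
Definition haar1 (e : bool) (k m : int) (t : R) : R :=
  itv_length k m `^ (- 2^-1) *
  (if e then \1_(dyadic_itv k m) t
   else \1_(dyadic_itv (k - 1) (2 * m + 1)) t -
        \1_(dyadic_itv (k - 1) (2 * m)) t).

End dyadic.

(* (k, m) stands for the cube with sides [2^k m_i, 2^k (m_i + 1)[; for n >= 1
   distinct pairs give distinct cubes. *)
Definition dyadic_cube (n : nat) : Type := (int * {ffun 'I_n -> int})%type.

Section sobolev.
Context {R : realType} {n : nat}.

Definition cube_set (Q : dyadic_cube n) : set (n.-tuple R) :=
  [set x | forall i, dyadic_itv Q.1 (Q.2 i) (tnth x i)].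

Definition cube_volume (Q : dyadic_cube n) : R :=
  fine (lebesgue_tuple n (cube_set Q)).

Definition haar (Q : dyadic_cube n) (e : {ffun 'I_n -> bool})
    (x : n.-tuple R) : R :=
  \prod_(i < n) haar1 (e i) Q.1 (Q.2 i) (tnth x i).

Definition haar_indices : set (dyadic_cube n * {ffun 'I_n -> bool}) :=
  [set j | j.2 <> [ffun=> true]].

Definition inner (f g : n.-tuple R -> R) : R :=
  \int[lebesgue_tuple n]_x (f x * g x).

(* Elements of L^2 are represented by Borel functions; membership depends only
   on the class of f modulo equality almost everywhere. *)
Definition dyadic_sobolev (s : R) : set (n.-tuple R -> R) :=
  [set f | f \in Lfun (lebesgue_tuple n) 2%:E /\
    (\esum_(j in haar_indices)
      (cube_volume j.1 `^ (- (2 * s / n%:R)) *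
       `|inner f (haar j.1 j.2)| ^+ 2)%:E < +oo)%E].

End sobolev.

Arguments dyadic_sobolev {R} n s.

(* Main.v *)
Require Import Defs.
From HB Require Import structures.
From mathcomp Require Import all_boot all_order all_algebra.
From mathcomp Require Import all_classical all_reals all_analysis.
From mathcomp Require Import measurable_realfun.
From mathcomp Require Import ring lra zify.

Set Implicit Arguments.
Unset Strict Implicit.
Unset Printing Implicit Defensive.

Import Order.TTheory GRing.Theory Num.Theory.
Import numFieldNormedType.Exports.

Local Open Scope classical_set_scope.
Local Open Scope ring_scope.

(** Put v = 2^n and w = 2^(2s). A cube Q of side 2^k has measure v^k and weight
|Q|^(-2s/n) = w^(-k), so f belongs to the space iff f is in L^2 and the sum of
w^(-k) E(Q) over all cubes is finite, where the energy E(Q) is the sum of the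
squares of the Haar coefficients of f on Q ([dyadic_sobolevP]). The averages of
f over the cubes of side 2^k form a martingale, and passing from Q to one of
its children changes the average by the Haar terms of Q only, hence by at most
(v E(Q) / |Q|)^(1/2) ([cube_mean_child], [cube_mean_child_sqr]).

Let s > n/2, that is w > v. Each energy is at most a constant times w^k, so the
changes of the averages are at most a constant times (w/v)^(k/2), which is
summable as k tends to -oo. The averages converge uniformly to a bounded
function, which has the same integral as f over every dyadic cube and therefore
equals f almost everywhere ([ae_bounded_cvg]). So elements of the space are
bounded. For bounded f and g and c the average of g over Q,
  (f g, h) = (f (g - c), h) + c (f, h),
so the energy of f g on Q is at most a constant times the integral of
(g - c)^2 over Q plus the energy of f on Q ([haar_energy_mul]). It remains to
sum the first terms: g minus its averages at level k telescopes into the steps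
at the levels k, k - 1, and so on, and a weighted Cauchy-Schwarz inequality with
weights th^i, 1 < th < w, bounds the integral of its square by a constant times
the sum over i of th^i times the energy of g at level k - i. Against the weight
w^(-k) this is a convergent geometric series in th / w times the finite sum for
g ([deviation_sum_lty]).

Let s <= n/2, that is w <= v, and put p = (v/w)^(1/2) >= 1. The counterexample
is f = sum_k c_k 1_[0, 2^-k)^n with c_k = p^k (k+1)^(-3/4). A nonnegative
combination of these nested indicators has nonzero Haar coefficients only on the
cubes [0, 2^K)^n, and they are, up to sign and normalisation, the tails of the
sum of c_k v^(-k) ([inner_chain]). For f the weighted squares are
O((j+1)^(-3/2)) on [0, 2^-j)^n, and geometrically small on the large cubes
([sobolev_sum_spike_lty]). But f^2 is a combination of the same kind with larger
coefficients, for which the weighted squares are at least a constant times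
1/(j+2) ([sobolev_sum_spike_sqr]). *)

(** * Dyadic intervals and the one-dimensional Haar functions *)

Section dyadic_line.
Context {R : realType}.
Implicit Types (k m : int) (t : R).

Definition dyadic_index k t : int := Num.floor (t / 2 ^ k).

Lemma dyadic_itvP k m t : Defs.dyadic_itv k m t <-> dyadic_index k t = m.
Proof.
have k0 : 0 < (2 : R) ^ k by rewrite exprz_gt0.
rewrite /Defs.dyadic_itv /= in_itv /= /dyadic_index; split=> [/andP[lm mu]|<-].
  apply/eqP; rewrite floor_eq ler_pdivlMr// ltr_pdivrMr//.
  by rewrite mulrC lm mulrC mu.
have := floor_itv (t / 2 ^ k); rewrite ler_pdivlMr// ltr_pdivrMr//.
by rewrite ![2 ^ k * _]mulrC.
Qed.

Lemma dyadic_itv_half k m t :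
  Defs.dyadic_itv k m t <->
  exists b : bool, Defs.dyadic_itv (k - 1) (2 * m + b%:Z) t.
Proof.
have k0 : 0 < (2 : R) ^ (k - 1) by rewrite exprz_gt0.
have kE : (2 : R) ^ k = 2 ^ (k - 1) * 2.
  by rewrite -{1}(subrK 1 k) expfzDr// expr1z.
rewrite /Defs.dyadic_itv /= in_itv /= kE; split=> [/andP[lm mu]|[b]].
  have [h|h] := ltP t (2 ^ (k - 1) * (2 * m + 1)%:~R).
    exists false; rewrite in_itv /= addr0 h andbT.
    by apply: le_trans lm; rewrite -mulrA intrM.
  exists true; rewrite in_itv /= h /=.
  apply: (lt_le_trans mu); rewrite -mulrA ler_pM2l// !(intrD, intrM) /=; lra.
rewrite in_itv /= => /andP[lm mu]; rewrite -!mulrA; apply/andP; split.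
  apply: le_trans lm; rewrite ler_pM2l// !(intrD, intrM) lerDl.
  by rewrite ler0n.
apply: (lt_le_trans mu); rewrite ler_pM2l// !(intrD, intrM).
have : (b%:Z)%:~R <= 1 :> R by case: b {mu lm}.
move=> /=; lra.
Qed.

Lemma indic_dyadic_half k m t : \1_(Defs.dyadic_itv k m) t =
  \sum_(b : bool) \1_(Defs.dyadic_itv (k - 1) (2 * m + b%:Z)) t :> R.
Proof.
rewrite big_bool /= !indicE.
have [h|h] := pselect (Defs.dyadic_itv k m t).
  rewrite (mem_set h); have /dyadic_itv_half[[] hb] := h.
    rewrite (mem_set hb) memNset ?addr0//.
    by move/dyadic_itvP: hb => e /dyadic_itvP; rewrite e; lia.
  rewrite (mem_set hb) memNset ?add0r//.
  by move/dyadic_itvP: hb => e /dyadic_itvP; rewrite e; lia.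
rewrite memNset// !memNset ?addr0// => hb; apply: h; apply/dyadic_itv_half.
  by exists false; rewrite addr0.
by exists true.
Qed.

Lemma measurable_dyadic_itv k m : measurable (Defs.dyadic_itv k m : set R).
Proof. exact: measurable_itv. Qed.

Lemma lebesgue_dyadic_itv k m :
  lebesgue_measure (Defs.dyadic_itv k m : set R) = ((2 : R) ^ k)%:E.
Proof.
have k0 : 0 < (2 : R) ^ k by rewrite exprz_gt0.
rewrite /Defs.dyadic_itv lebesgue_measure_itv /= lte_fin ltr_pM2l// ltr_int ltrDl /=.
by rewrite -EFinB -mulrBr intrD addrAC subrr add0r mulr1.
Qed.

Lemma itv_lengthE k m : itv_length k m = (2 : R) ^ k.
Proof. by rewrite /itv_length lebesgue_dyadic_itv. Qed.

(** The sign of h^e on the left (b = false) or right (b = true) half. *)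
Definition half_sign (e b : bool) : R := if e || b then 1 else -1.

Lemma haar1_half e k m t : haar1 e k m t = (2 ^ k) `^ (- 2^-1) *
  \sum_(b : bool) half_sign e b * \1_(Defs.dyadic_itv (k - 1) (2 * m + b%:Z)) t.
Proof.
rewrite /haar1 itv_lengthE; congr (_ * _).
rewrite big_bool /half_sign /= orbT orbF !mul1r.
case: e; first by rewrite indic_dyadic_half big_bool /= mul1r.
by rewrite mulN1r addr0.
Qed.

End dyadic_line.

(** * Dyadic cubes, their children and the Haar functions *)

Section cubes.
Context {R : realType} {n : nat}.
Implicit Types (Q : dyadic_cube n) (e b : {ffun 'I_n -> bool}).
Implicit Types (x : n.-tuple R).
Local Notation mu := (@lebesgue_tuple R n).

(** For fixed k these cubes partition the space; membership in a cube becomes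
an equation between indices in [cube_setP]. *)
Definition cube_at (k : int) x : dyadic_cube n :=
  (k, [ffun i => dyadic_index k (tnth x i)]).

Lemma cube_setP Q x : cube_set Q x <-> cube_at Q.1 x = Q.
Proof.
case: Q => k m; rewrite /cube_set /cube_at /=; split => [Qx|[<-] i].
  by congr (_, _); apply/ffunP => i; rewrite ffunE; apply/dyadic_itvP.
by rewrite ffunE; exact/dyadic_itvP.
Qed.

Lemma cube_set_at k x : cube_set (cube_at k x) x.
Proof. exact/cube_setP. Qed.

(** The bit b i selects the left or the right half of the i-th side. *)
Definition child Q b : dyadic_cube n :=
  (Q.1 - 1, [ffun i => 2 * Q.2 i + (b i)%:Z]).

Definition child_sign e b : R := \prod_(i < n) half_sign (e i) (b i).

Lemma indic_cube Q x :
  \1_(cube_set Q) x = \prod_(i < n) \1_(Defs.dyadic_itv Q.1 (Q.2 i)) (tnth x i)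
  :> R.
Proof.
rewrite indicE; have [Qx|Qx] := pselect (cube_set Q x).
  by rewrite mem_set// big1// => i _; rewrite indicE mem_set//; exact: Qx.
have [i Qi] : exists i, ~ Defs.dyadic_itv Q.1 (Q.2 i) (tnth x i).
  by apply/existsNP.
by rewrite memNset// (bigD1 i)//= indicE memNset// mul0r.
Qed.

Lemma indic_child Q x :
  \1_(cube_set Q) x = \sum_b \1_(cube_set (child Q b)) x :> R.
Proof.
rewrite indic_cube; under eq_bigr do rewrite indic_dyadic_half.
rewrite bigA_distr_bigA; apply: eq_bigr => b _.
by rewrite indic_cube; apply: eq_bigr => i _; rewrite ffunE.
Qed.

Lemma cube_set_child Q x :
  cube_set Q x <-> exists b, cube_set (child Q b) x.
Proof.
have := indic_child Q x; have [Qx|Qx] := pselect (cube_set Q x).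
  rewrite indicE mem_set// => h; split => // _; apply: contrapT => /forallNP nQ.
  move/eqP: h; rewrite big1 ?oner_eq0// => b _.
  by rewrite indicE memNset.
rewrite indicE memNset//= => h; split => // -[b xb].
move/eqP: h; rewrite (bigD1 b)//= indicE mem_set//= lt_eqF//.
by rewrite ltr_wpDr// sumr_ge0.
Qed.

Lemma measurable_cube Q : measurable (cube_set Q : set (n.-tuple R)).
Proof.
rewrite (_ : cube_set Q = \bigcap_(i in [set: 'I_n]) (setT `&`
    (fun x : n.-tuple R => tnth x i) @^-1` Defs.dyadic_itv Q.1 (Q.2 i))).
  apply: fin_bigcap_measurable => // i _.
  exact: (@measurable_tnth _ R n i measurableT) (measurable_dyadic_itv _ _).
apply/seteqP; split => x Qx i; first by move=> _; split => //; exact: Qx.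
by have [] := Qx i I.
Qed.

Lemma lebesgue_cubeE Q : mu (cube_set Q) = (((2 : R) ^ Q.1) ^+ n)%:E.
Proof.
rewrite (lebesgue_tuple_box (fun i => measurable_dyadic_itv Q.1 (Q.2 i))).
under eq_bigr do rewrite lebesgue_dyadic_itv.
by rewrite prodEFin prodr_const card_ord.
Qed.

Lemma cube_volumeE Q : cube_volume Q = ((2 : R) ^+ n) ^ Q.1.
Proof.
by rewrite /cube_volume lebesgue_cubeE /= !exprnP !exprz_exp mulrC.
Qed.

Lemma cube_volume_gt0 Q : 0 < cube_volume Q :> R.
Proof. by rewrite cube_volumeE exprz_gt0// exprn_gt0. Qed.

Lemma lebesgue_cube Q : mu (cube_set Q) = (cube_volume Q)%:E.
Proof. by rewrite /cube_volume lebesgue_cubeE. Qed.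

Lemma cube_volume_child Q b :
  cube_volume Q = 2 ^+ n * cube_volume (child Q b) :> R.
Proof.
rewrite !cube_volumeE /= expfzDr ?expf_neq0// mulrCA exprN1 divff ?mulr1//.
Qed.

Definition haar_norm Q : R := cube_volume Q `^ (- 2^-1).

Lemma haar_norm_sqr Q : haar_norm Q ^+ 2 = (cube_volume Q)^-1.
Proof.
rewrite /haar_norm -powR_mulrn ?powR_ge0// -powRrM mulNr mulVf//.
by rewrite powR_inv1// ltW// cube_volume_gt0.
Qed.

(** Expanding the product over the coordinates turns the product of the
one-dimensional decompositions into a sum over the children of Q. *)
Lemma haar_child Q e x :
  haar Q e x = haar_norm Q *
    \sum_b child_sign e b * \1_(cube_set (child Q b)) x.
Proof.
rewrite /haar; under eq_bigr do rewrite haar1_half.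
rewrite big_split /= prodr_const card_ord; congr (_ * _).
  rewrite /haar_norm cube_volumeE.
  rewrite (_ : (2 ^+ n) ^ Q.1 = (2 ^ Q.1) ^+ n); last first.
    by rewrite !exprnP !exprz_exp mulrC.
  have k0 : 0 <= (2 : R) ^ Q.1 by rewrite ltW// exprz_gt0.
  rewrite -(powR_mulrn n (powR_ge0 _ _)) -(powR_mulrn n k0) -!powRrM.
  by rewrite mulrC.
rewrite bigA_distr_bigA; apply: eq_bigr => b _.
rewrite big_split indic_cube; congr (_ * _).
by apply: eq_bigr => i _; rewrite ffunE.
Qed.

Lemma half_sign_sqr (e0 b0 : bool) : (half_sign e0 b0 : R) ^+ 2 = 1.
Proof. by case: e0 b0 => -[]; rewrite /half_sign /= ?sqrrN expr1n. Qed.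

Lemma child_sign_sqr e b : child_sign e b ^+ 2 = 1.
Proof.
by rewrite /child_sign -prodrXl big1// => i _; rewrite half_sign_sqr.
Qed.

Lemma child_sign_true b : child_sign [ffun=> true] b = 1.
Proof. by rewrite /child_sign big1// => i _; rewrite ffunE. Qed.

(** The zero mean of the Haar functions: the sum over b factors over the
coordinates, and a coordinate with e i = false contributes 1 - 1. *)
Lemma sum_child_sign e : e <> [ffun=> true] -> \sum_b child_sign e b = 0.
Proof.
move=> /eqP e1; have [i /negbTE ei] : exists i, ~~ e i.
  apply/existsP; apply: contra_neqT e1 => /existsPn h; apply/ffunP => i.
  by rewrite ffunE; move: (h i); case: (e i).
rewrite /child_sign -(bigA_distr_bigA (fun i => half_sign (e i))).
by rewrite (bigD1 i)//= big_bool ei /half_sign /= subrr mul0r.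
Qed.

(** Orthogonality of the columns of the Walsh matrix, again by factoring over
the coordinates. All e occur here, including the constant one: the matrix is
square, which makes the Haar functions on Q span all step functions on its
children. *)
Lemma child_sign_orthogonal b b' :
  \sum_e child_sign e b * child_sign e b' = 2 ^+ n * (b == b')%:R.
Proof.
rewrite /child_sign; under eq_bigr do rewrite -big_split /=.
rewrite -(bigA_distr_bigA
  (fun i (c : bool) => half_sign c (b i) * half_sign c (b' i) : R)).
have [<-|/eqP bb'] := eqVneq b b'.
  rewrite mulr1 (eq_bigr (fun=> 2)) ?prodr_const ?card_ord// => i _.
  by rewrite big_bool /= -!expr2 !half_sign_sqr.
have [i bi] : exists i, b i != b' i.
  apply/existsP; apply: contra_notT bb' => /existsPn h; apply/ffunP => i.
  by apply/eqP; move: (h i); rewrite negbK.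
rewrite mulr0 (bigD1 i)//=; apply/eqP; rewrite mulf_eq0 big_bool.
apply/orP; left; apply/eqP.
by move: bi; case: (b i) (b' i) => -[] //= _; rewrite /half_sign /=; ring.
Qed.

End cubes.

(** * Integrals and square-integrable functions *)

Section integral_facts.
Context d {T : measurableType d} {R : realType}.
Variable mu : {measure set T -> \bar R}.
Implicit Types (D : set T) (f g : T -> R).

Lemma Rintegral_step (I : finType) (c : I -> R) (A : I -> set T) f :
  (forall i, measurable (A i)) ->
  (forall i, mu.-integrable (A i) (EFin \o f)) ->
  \int[mu]_x (f x * \sum_i c i * \1_(A i) x) =
  \sum_i c i * \int[mu]_(x in A i) f x.
Proof.
move=> mA fA.
have fAT i : mu.-integrable setT (EFin \o (fun x => f x * \1_(A i) x)).
  have /(integrable_mkcond _ (mA i)) := fA i.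
  by rewrite restrict_EFin patch_indic.
have -> : \int[mu]_x (f x * \sum_i c i * \1_(A i) x) =
    fine (\int[mu]_x \sum_i ((c i)%:E * (f x * \1_(A i) x)%:E))%E.
  congr fine; apply: eq_integral => x _; rewrite mulr_sumr -sumEFin.
  by apply: eq_bigr => i _; rewrite -EFinM mulrCA.
rewrite integral_sum//; last by move=> i; apply: integrableZl => //; exact: fAT.
rewrite -sum_fine; last first.
  move=> i _; apply: integrable_fin_num => //.
  by apply: integrableZl => //; exact: fAT.
apply: eq_bigr => i _.
rewrite integralZl//; last exact: fAT.
rewrite fineM//; last by apply: integrable_fin_num => //; exact: fAT.
by rewrite [in RHS]Rintegral_mkcond patch_indic.
Qed.

Lemma Lfun2P f : f \in Lfun mu 2%:E <->
  measurable_fun setT f /\ (\int[mu]_x (f x ^+ 2)%:E < +oo)%E.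
Proof.
have sqE : (\int[mu]_x (`|f x| `^ 2)%:E = \int[mu]_x (f x ^+ 2)%:E)%E.
  by apply: eq_integral => x _; rewrite powR_mulrn// real_normK// num_real.
split=> [f2|[mf f2]].
  split; first by move: f2; rewrite inE => /andP[/[!inE]].
  have /integrableP[_] := Lfun2_integrable_sqr f2.
  by under eq_integral do rewrite /= ger0_norm ?sqr_ge0//.
rewrite inE; apply/andP; split; rewrite inE//= /finite_norm unlock /Lnorm /=.
by rewrite poweR_lty// sqE.
Qed.

Lemma sqr_integrable D f : measurable D -> measurable_fun setT f ->
  (\int[mu]_x (f x ^+ 2)%:E < +oo)%E ->
  mu.-integrable D (EFin \o (fun x => f x ^+ 2)).
Proof.
move=> mD mf f2; apply: (@integrableS _ _ _ _ setT) => //.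
apply/integrableP; split.
  by apply/measurable_EFinP; exact: measurable_funX.
by under eq_integral do rewrite /= ger0_norm ?sqr_ge0//.
Qed.

Lemma integrable_cst_lty D (k : R) : measurable D -> (mu D < +oo)%E ->
  mu.-integrable D (EFin \o cst k).
Proof.
move=> mD Doo; apply: measurable_bounded_integrable => //.
exact: bounded_cst.
Qed.

(** From |f| <= 1 + f^2. *)
Lemma integrable_of_sqr D f : measurable D -> (mu D < +oo)%E ->
  measurable_fun setT f ->
  mu.-integrable D (EFin \o (fun x => f x ^+ 2)) ->
  mu.-integrable D (EFin \o f).
Proof.
move=> mD Doo mf f2.
have i1 : mu.-integrable D (EFin \o cst 1) by exact: integrable_cst_lty.
apply: le_integrable (integrableD mD i1 f2) => //.
  by apply/measurable_EFinP; exact: measurable_funTS.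
move=> x _ /=; rewrite lee_fin (@ger0_norm _ (1 + _)) ?addr_ge0 ?sqr_ge0//.
have := sqr_ge0 (`|f x| - 1); rewrite -(real_normK (num_real (f x))) sqrrB.
have := sqr_ge0 (`|f x|); nra.
Qed.

(** Cauchy-Schwarz against the constant 1, from the nonnegativity of the
variance of f over D. *)
Lemma sqr_Rintegral_le D f (m : R) : measurable D -> mu D = m%:E -> 0 < m ->
  measurable_fun setT f ->
  mu.-integrable D (EFin \o (fun x => f x ^+ 2)) ->
  (\int[mu]_(x in D) f x) ^+ 2 <= m * \int[mu]_(x in D) (f x ^+ 2).
Proof.
move=> mD muD m0 mf f2.
have Doo : (mu D < +oo)%E by rewrite muD ltry.
have f1 := integrable_of_sqr mD Doo mf f2.
set a := \int[mu]_(x in D) f x; set c := a / m.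
have icst k : mu.-integrable D (EFin \o cst k) by exact: integrable_cst_lty.
have ifc : mu.-integrable D (EFin \o (fun x => 2 * c * f x)).
  exact: (integrableZl mD (2 * c) f1).
have : 0 <= \int[mu]_(x in D) (f x ^+ 2 - 2 * c * f x + c ^+ 2).
  apply: Rintegral_ge0 => x _.
  suff -> : f x ^+ 2 - 2 * c * f x + c ^+ 2 = (f x - c) ^+ 2 by exact: sqr_ge0.
  by ring.
rewrite (RintegralD mD (integrableB mD f2 ifc) (icst _)) RintegralB//.
rewrite RintegralZl// Rintegral_cst// muD /= -/a => h.
have {}h : 0 <= \int[mu]_(x in D) (f x ^+ 2) - 2 * (a / m) * a +
  (a / m) ^+ 2 * m := h.
have -> : a ^+ 2 = m * (2 * (a / m) * a - (a / m) ^+ 2 * m).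
  by field; rewrite gt_eqF.
by rewrite ler_pM2l//; lra.
Qed.

End integral_facts.

(** * Haar coefficients and averages over cubes *)

Section haar_coefficients.
Context {R : realType} {n : nat}.
Implicit Types (Q : dyadic_cube n) (e b : {ffun 'I_n -> bool}).
Implicit Types (x : n.-tuple R) (f g : n.-tuple R -> R).
Local Notation mu := (@lebesgue_tuple R n).

Definition cube_int f Q : R := \int[mu]_(x in cube_set Q) f x.

Definition cube_mean f Q : R := cube_int f Q / cube_volume Q.

(** Local integrability; every bounded set lies in finitely many cubes. *)
Definition cube_integrable f :=
  forall Q, mu.-integrable (cube_set Q) (EFin \o f).

Lemma lebesgue_cube_lty Q : (mu (cube_set Q) < +oo)%E.
Proof. by rewrite lebesgue_cube ltry. Qed.

Lemma cube_integrable_L2 f : f \in Lfun mu 2%:E -> cube_integrable f.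
Proof.
move=> /Lfun2P[mf f2] Q.
have mQ : measurable (cube_set Q : set (n.-tuple R)) := measurable_cube Q.
apply: integrable_of_sqr => //; first exact: lebesgue_cube_lty.
exact: sqr_integrable.
Qed.

(** This makes every statement about Haar coefficients an identity between
finitely many integrals over children. *)
Lemma inner_haar f Q e : cube_integrable f ->
  inner f (haar Q e) =
  haar_norm Q * \sum_b child_sign e b * cube_int f (child Q b).
Proof.
move=> fi; rewrite /inner.
have -> : (fun x => f x * haar Q e x) = (fun x => f x *
    \sum_b (haar_norm Q * child_sign e b) * \1_(cube_set (child Q b)) x).
  apply/funext => x; rewrite haar_child mulr_sumr; congr (_ * _).
  by apply: eq_bigr => b _; rewrite mulrA.
rewrite Rintegral_step; [|by move=> b; exact: measurable_cube|by move=> b].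
by rewrite mulr_sumr; apply: eq_bigr => b _; rewrite mulrA.
Qed.

Lemma cube_int_child f Q : cube_integrable f ->
  cube_int f Q = \sum_b cube_int f (child Q b).
Proof.
move=> fi; rewrite /cube_int Rintegral_mkcond patch_indic.
rewrite (_ : f \* _ = (fun x => f x *
    \sum_b 1 * \1_(cube_set (child Q b)) x)); last first.
  apply/funext => x /=; rewrite indic_child; congr (_ * _).
  by apply: eq_bigr => b _; rewrite mul1r.
rewrite Rintegral_step; [|by move=> b; exact: measurable_cube|by move=> b].
by apply: eq_bigr => b _; rewrite mul1r.
Qed.

(** Both averages are inner products with normalised indicators, and
[child_sign_orthogonal] expands the indicator of the child in the functions
h_Q^e; the term with e identically true is the average over Q. *)
Lemma cube_mean_child f Q b : cube_integrable f ->
  cube_mean f (child Q b) - cube_mean f Q =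
  haar_norm Q *
    \sum_(e | e != [ffun=> true]) inner f (haar Q e) * child_sign e b.
Proof.
move=> fi.
have tot : haar_norm Q * \sum_e inner f (haar Q e) * child_sign e b =
    cube_mean f (child Q b).
  under eq_bigr do rewrite inner_haar//.
  transitivity (haar_norm Q ^+ 2 * \sum_e \sum_b'
      child_sign e b * child_sign e b' * cube_int f (child Q b')).
    rewrite expr2 -mulrA [in RHS]mulr_sumr; congr (_ * _).
    apply: eq_bigr => e _; rewrite -mulrA; congr (_ * _).
    rewrite mulr_suml; apply: eq_bigr => b' _; ring.
  rewrite exchange_big /=.
  under eq_bigr do rewrite -mulr_suml child_sign_orthogonal.
  rewrite (bigD1 b)//= eqxx mulr1 big1 ?addr0; last first.
    by move=> b' b'b; rewrite eq_sym (negbTE b'b) mulr0 mul0r.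
  rewrite haar_norm_sqr /cube_mean (cube_volume_child Q b).
  have := cube_volume_gt0 (R := R) (child Q b) => /lt0r_neq0 v0.
  by field; rewrite v0 expf_neq0.
rewrite -tot (bigD1 [ffun=> true])//= mulrDr.
suff -> : cube_mean f Q = haar_norm Q *
    (inner f (haar Q [ffun=> true]) * child_sign [ffun=> true] b).
  by rewrite addrAC subrr add0r.
rewrite inner_haar// child_sign_true mulr1.
under eq_bigr do rewrite child_sign_true mul1r.
by rewrite -cube_int_child// mulrA -expr2 haar_norm_sqr mulrC.
Qed.

End haar_coefficients.

(** * Dyadic cubes generate the measurable sets *)

Lemma sigma_algebra_countable_bigcup (T : Type) (S : set (set T))
    (I : countType) (P : set I) (F : I -> set T) :
  sigma_algebra setT S -> (forall i, P i -> S (F i)) ->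
  S (\bigcup_(i in P) F i).
Proof.
move=> [S0 _ Sbigcup] SF.
pose G k := if pickle_inv k is Some i then if i \in P then F i else set0
            else set0 : set T.
rewrite (_ : \bigcup_(i in P) F i = \bigcup_k G k).
  apply: Sbigcup => k; rewrite /G; case: pickle_inv => // i.
  by case: ifPn => // /set_mem /SF.
apply/seteqP; split => x [].
  by move=> i Pi Fix; exists (pickle i) => //; rewrite /G pickleK_inv mem_set.
move=> k _; rewrite /G; case: pickle_inv => // i; case: ifPn => // /set_mem Pi.
by exists i.
Qed.

Section density.
Context d {T : measurableType d} {R : realType}.
Variable mu : {measure set T -> \bar R}.
Variable phi : T -> R.
Hypothesis mphi : measurable_fun setT phi.
Hypothesis phi0 : forall x, 0 <= phi x.

(** The hypotheses on phi are arguments so that the measure structure can be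
attached to the set function. *)
Definition density of measurable_fun setT phi & (forall x, 0 <= phi x) :=
  fun A : set T => (\int[mu]_(x in A) (phi x)%:E)%E.

Local Notation nu := (density mphi phi0).

Let nu0 : nu set0 = 0%E. Proof. exact: integral_set0. Qed.

Let nu_ge0 A : (0 <= nu A)%E.
Proof. by apply: integral_ge0 => x _; rewrite lee_fin. Qed.

Let nu_sigma_additive : semi_sigma_additive nu.
Proof.
move=> F mF tF mUF; rewrite /density ge0_integral_bigcup//.
- by apply: is_cvg_ereal_nneg_natsum => k _; exact: nu_ge0.
- by apply/measurable_EFinP; exact: measurable_funTS.
- by move=> x _; rewrite lee_fin.
Qed.

HB.instance Definition _ := isMeasure.Build _ _ _ nu
  nu0 nu_ge0 nu_sigma_additive.

Definition density_measure : {measure set T -> \bar R} := nu.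

Lemma density_measureE A :
  density_measure A = (\int[mu]_(x in A) (phi x)%:E)%E.
Proof. by []. Qed.

End density.

Lemma half_expn_lt (R : realType) (a : R) : 0 < a -> exists N, 2 ^- N < a.
Proof.
move=> a0; exists (Num.bound a^-1).
rewrite invf_plt ?posrE ?exprn_gt0//.
have a1 : 0 <= a^-1 by rewrite invr_ge0 ltW.
apply: (lt_trans (archi_boundP a1)).
by rewrite -natrX ltr_nat ltn_expl.
Qed.

Section grid.
Context {R : realType} {n : nat}.
Implicit Types (Q : dyadic_cube n) (e b : {ffun 'I_n -> bool}).
Implicit Types (x : n.-tuple R) (f g : n.-tuple R -> R).
Local Notation mu := (@lebesgue_tuple R n).

(** The parent of a cube is determined by the cube. *)
Lemma cube_at_coarser (k l : int) x (y : n.-tuple R) :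
  cube_at k x = cube_at k y -> k <= l -> cube_at l x = cube_at l y.
Proof.
move=> xy; rewrite -subr_ge0 -[l in RHS](subrK k) -[l in LHS](subrK k).
case: (l - k) => // j _; elim: j => [|j IH]; first by rewrite add0r.
pose Q := cube_at (j.+1%:Z + k) x.
have [b xb] : exists b, cube_set (child Q b) x.
  by apply/cube_set_child; exact: cube_set_at.
have Q1 : (child Q b).1 = j%:Z + k.
  by rewrite /= -addn1 PoszD addrAC addrK.
suff Qy : cube_set Q y by move/cube_setP: Qy.
apply/cube_set_child; exists b; apply/cube_setP.
by rewrite Q1 -IH -Q1; exact/cube_setP.
Qed.

(** Two dyadic cubes are nested or disjoint: a cube of level k determines the
cube of each coarser level that contains it. *)
Lemma cube_set_nested Q (Q' : dyadic_cube n) x :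
  cube_set Q x -> cube_set Q' x -> Q.1 <= Q'.1 ->
  cube_set Q `<=` (cube_set Q' : set (n.-tuple R)).
Proof.
move=> /cube_setP Qx /cube_setP Q'x le y /cube_setP Qy; apply/cube_setP.
by rewrite -Q'x; apply/esym/(cube_at_coarser _ le); rewrite Qx Qy.
Qed.

(** The empty set is added to obtain a pi-system. *)
Definition grid : set (set (n.-tuple R)) :=
  [set A | A = set0 \/ exists Q, A = cube_set Q].

Lemma grid_setI_closed : setI_closed grid.
Proof.
move=> A B [->|[Q ->]]; first by left; rewrite set0I.
move=> [->|[Q' ->]]; first by left; rewrite setI0.
have [[x [Qx Q'x]]|QQ'] := pselect (exists x, (cube_set Q `&` cube_set Q') x);
  last by left; apply/seteqP; split => // x Hx; apply: QQ'; exists x.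
right; have [le|/ltW le] := leP Q.1 Q'.1.
  by exists Q; apply/setIidPl; exact: cube_set_nested le.
by exists Q'; apply/setIidPr; exact: cube_set_nested le.
Qed.

(** An open half-space is the union of the dyadic cubes that it contains. *)
Lemma grid_halfspace (i : 'I_n) (a : R) :
  <<s grid >> [set x : n.-tuple R | a < tnth x i].
Proof.
rewrite (_ : mkset _ = \bigcup_(Q in [set Q : dyadic_cube n |
    cube_set Q `<=` [set x : n.-tuple R | a < tnth x i]]) cube_set Q).
  apply: sigma_algebra_countable_bigcup; first exact: smallest_sigma_algebra.
  by move=> Q _; apply: sub_sigma_algebra; right; exists Q.
apply/seteqP; split => [x /= ax|x [Q /= sQ Qx]]; last exact: sQ.
have /half_expn_lt[N hN] : 0 < tnth x i - a by rewrite subr_gt0.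
exists (cube_at (- N%:Z) x) => /=; last exact: cube_set_at.
move=> y /(_ i) /=; have := cube_set_at (- N%:Z) x i.
rewrite /Defs.dyadic_itv /= !in_itv /= => /andP[_ hx] /andP[hy _].
have e : 2 ^ (- N%:Z) = 2 ^- N :> R by rewrite -exprnN.
have : tnth x i - 2 ^- N < tnth y i.
  rewrite ltrBlDr; apply: (lt_le_trans hx).
  by rewrite intrD mulrDr mulr1 e lerD2r -e.
by apply: le_lt_trans; rewrite lerBrDl -lerBrDr ltW.
Qed.

(** The coordinate functions generate the measurable sets, and their
half-spaces are generated by the cubes. *)
Lemma measurable_grid : @measurable _ (n.-tuple R) = <<s grid >>.
Proof.
apply/seteqP; split; last first.
  apply: smallest_sub; first exact: sigma_algebra_measurable.
  by move=> _ [->|[Q ->]]; [exact: measurable0|exact: measurable_cube].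
apply: smallest_sub; first exact: smallest_sigma_algebra.
apply: (big_ind (fun S : set (set (n.-tuple R)) => S `<=` <<s grid >>)) => //.
  by move=> S1 S2 h1 h2 A [/h1|/h2].
move=> i _ _ [B mB <-].
pose T := g_sigma_algebraType grid.
have mi : measurable_fun [set: T] (fun x : T => tnth (x : n.-tuple R) i : R).
  apply: (measurability _ (RGenOInfty.measurableE R)) => _ [_ [a ->] <-].
  rewrite setTI (_ : _ @^-1` _ = [set x | a < tnth x i]).
    exact: grid_halfspace.
  by apply/seteqP; split => x; rewrite /= in_itv /= andbT.
exact: (mi measurableT B mB).
Qed.

End grid.

(** * Functions are determined by their integrals over dyadic cubes *)

Section levels.
Context {R : realType} {n : nat}.
Implicit Types (Q : dyadic_cube n) (k : int).
Implicit Types (x : n.-tuple R) (f g : n.-tuple R -> R).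
Local Notation mu := (@lebesgue_tuple R n).

Lemma measurable_fun_cube_at k (F : dyadic_cube n -> R) :
  measurable_fun setT (fun x : n.-tuple R => F (cube_at k x)).
Proof.
move=> _ Y mY; rewrite setTI.
rewrite (_ : _ @^-1` _ =
  \bigcup_(m in [set m : {ffun 'I_n -> int} | Y (F (k, m))]) cube_set (k, m)).
  apply: sigma_algebra_countable_bigcup; first exact: sigma_algebra_measurable.
  by move=> m _; exact: measurable_cube.
apply/seteqP; split => [x Yx|x [m Ym /cube_setP /= xm]] /=.
  by exists (cube_at k x).2 => //; exact: (cube_set_at k x).
by rewrite xm.
Qed.

(** The cubes of level k form a countable partition of the space. *)
Lemma ge0_integral_cubes k (phi : n.-tuple R -> \bar R) :
  measurable_fun setT phi -> (forall x, (0 <= phi x)%E) ->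
  (\int[mu]_x phi x = \esum_(m in [set: {ffun 'I_n -> int}])
    \int[mu]_(x in cube_set (k, m)) phi x)%E.
Proof.
move=> mphi phi0.
pose F i : set (n.-tuple R) :=
  if pickle_inv i is Some m then cube_set (k, m) else set0.
have FT : \bigcup_i F i = setT.
  apply/seteqP; split => // x _; exists (pickle (cube_at k x).2) => //.
  by rewrite /F pickleK_inv; exact: (cube_set_at k x).
have F0 i : (0 <= \int[mu]_(x in F i) phi x)%E by exact: integral_ge0.
rewrite -[in LHS]FT ge0_integral_bigcup//=; first last.
- apply/trivIsetP => i j _ _ ij; apply/seteqP; split => // x [].
  rewrite /F; case Ei : (pickle_inv i) => [m|//].
  case Ej : (pickle_inv j) => [l|//].
  move=> /cube_setP /= xm /cube_setP /=; rewrite xm => -[ml]; move/eqP: ij; apply.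
  have := pickle_invK (T := {ffun 'I_n -> int}) i.
  have := pickle_invK (T := {ffun 'I_n -> int}) j.
  by rewrite Ei Ej ml /= => <- <-.
- by rewrite FT.
- by move=> i; rewrite /F; case: pickle_inv => // m; exact: measurable_cube.
rewrite nneseries_esumT//.
rewrite (esumID (pickle @` [set: {ffun 'I_n -> int}]))//.
rewrite [X in (_ + X)%E]esum1 ?adde0; last first.
  move=> i [_ ni]; rewrite /F; case Ei : pickle_inv => [m|]; last first.
    by rewrite integral_set0.
  exfalso; apply: ni; exists m => //.
  by have := pickle_invK (T := {ffun 'I_n -> int}) i; rewrite Ei.
rewrite setTI esum_image; last by move=> m l _ _; exact: (pcan_inj pickleK_inv).
by apply: eq_esum => m _; rewrite /F pickleK_inv.
Qed.

Lemma integrable_maxr0 (D : set (n.-tuple R)) f : measurable D ->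
  measurable_fun setT f -> mu.-integrable D (EFin \o f) ->
  mu.-integrable D (EFin \o (fun x => Num.max (f x) 0)).
Proof.
move=> mD mf fi; apply: le_integrable fi => //.
  apply/measurable_EFinP; apply: measurable_funTS.
  by apply: measurable_maxr => //; exact: measurable_cst.
move=> x _ /=; rewrite lee_fin; case: (leP (f x) 0) => h //=.
by rewrite normr0.
Qed.

(** The positive and the negative part of f are densities of two measures that
agree on the pi-system of cubes, hence everywhere. On the set where f > 0 the
negative part vanishes, so the positive part integrates to zero there. *)
Lemma ae_le0_of_cube_int f : measurable_fun setT f -> cube_integrable f ->
  (forall Q, cube_int f Q = 0) -> {ae mu, forall x, f x <= 0}.
Proof.
move=> mf fi f0.
have mp : measurable_fun setT (fun x => Num.max (f x) 0).
  by apply: measurable_maxr => //; exact: measurable_cst.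
have mn : measurable_fun setT (fun x => Num.max (- f x) 0).
  by apply: measurable_maxr; [exact: measurableT_comp|exact: measurable_cst].
have pos0 (u : R) : 0 <= Num.max u 0 by rewrite le_max lexx orbT.
have maxE (u : R) : Num.max u 0 - Num.max (- u) 0 = u.
  by rewrite /Num.max oppr_lt0; case: ltgtP => h; lra.
pose m1 := density_measure mu mp (fun x => pos0 (f x)).
pose m2 := density_measure mu mn (fun x => pos0 (- f x)).
have ip Q : mu.-integrable (cube_set Q) (EFin \o (fun x => Num.max (f x) 0)).
  by apply: integrable_maxr0 => //; exact: measurable_cube.
have iN Q : mu.-integrable (cube_set Q) (EFin \o (fun x => Num.max (- f x) 0)).
  apply: integrable_maxr0; first exact: measurable_cube.
    exact: measurableT_comp.
  exact: (integrableN (fi Q)).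
pose g i : set (n.-tuple R) :=
  if pickle_inv i is Some m then cube_set (0, m) else set0.
have m12 A : measurable A -> m1 A = m2 A.
  apply: (measure_unique grid g).
  - exact: measurable_grid.
  - exact: grid_setI_closed.
  - move=> i; rewrite /g; case: pickle_inv => [m|]; last by left.
    by right; exists (0, m).
  - apply/seteqP; split => // x _; exists (pickle (cube_at 0 x).2) => //.
    by rewrite /g pickleK_inv; exact: (cube_set_at 0 x).
  - move=> _ [->|[Q ->]]; first by rewrite !measure0.
    have mQ := measurable_cube (R := R) Q.
    rewrite !density_measureE -[LHS]fineK; last exact: integrable_fin_num.
    rewrite -[RHS]fineK; last exact: integrable_fin_num.
    congr EFin; apply/eqP; rewrite -subr_eq0; apply/eqP.
    have := f0 Q; rewrite /cube_int.
    under eq_Rintegral => x _ do rewrite -[f x]maxE.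
    by rewrite RintegralB.
  - move=> i; rewrite /g; case: pickle_inv => [m|]; last by rewrite measure0.
    have := integrable_fin_num (measurable_cube (0, m)) (ip (0, m)).
    rewrite ge0_fin_numE//; apply: integral_ge0 => x _.
    by rewrite lee_fin pos0.
pose E := [set x | 0 < f x].
have mE : measurable E.
  rewrite (_ : E = setT `&` f @^-1` `]0, +oo[); first exact: mf.
  by rewrite setTI; apply/seteqP; split => x; rewrite /= in_itv /= andbT.
have iE0 : (\int[mu]_(x in E) `|(Num.max (f x) 0)%:E| = 0)%E.
  under eq_integral do rewrite gee0_abs ?lee_fin//.
  have := m12 E mE; rewrite /m1 /m2 !density_measureE => ->.
  under eq_integral => x /set_mem fx0.
    rewrite max_r; last by rewrite oppr_le0 ltW.
    over.
  by rewrite integral0.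
have mpE : measurable_fun E (EFin \o (fun x => Num.max (f x) 0)).
  by apply/measurable_EFinP; exact: measurable_funTS.
move/(ae_eq_integral_abs mu mE mpE) : iE0; apply: filterS => x h.
rewrite leNgt; apply/negP => fx0; have := h fx0.
by move=> /= -[]; rewrite max_l ?ltW// => e; rewrite e ltxx in fx0.
Qed.

Lemma ae_eq_of_cube_int f g : measurable_fun setT f -> measurable_fun setT g ->
  cube_integrable f -> cube_integrable g ->
  (forall Q, cube_int f Q = cube_int g Q) -> {ae mu, forall x, f x = g x}.
Proof.
move=> mf mg fi gi fg.
have lefg (u v : n.-tuple R -> R) : measurable_fun setT u ->
    measurable_fun setT v -> cube_integrable u -> cube_integrable v ->
    (forall Q, cube_int u Q = cube_int v Q) -> {ae mu, forall x, u x <= v x}.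
  move=> mu_ mv ui vi uv.
  have : {ae mu, forall x, u x - v x <= 0}.
    apply: ae_le0_of_cube_int.
    - exact: measurable_funB.
    - by move=> Q; exact: (integrableB (measurable_cube Q) (ui Q) (vi Q)).
    - move=> Q; rewrite /cube_int RintegralB//; last exact: measurable_cube.
        by rewrite -/(cube_int u Q) uv subrr.
  by apply: filterS => x; rewrite subr_le0.
have h1 := lefg f g mf mg fi gi fg.
have h2 := lefg g f mg mf gi fi (fun Q => esym (fg Q)).
by apply: filterS2 h1 h2 => x le1 le2; apply/eqP; rewrite eq_le le1.
Qed.

End levels.

(** * The martingale of averages and boundedness for s > n/2 *)

(** Cauchy-Schwarz, as the nonnegativity of a variance. The factor is the size
of the whole index type, which only weakens the bound. *)
Lemma sqr_sum_le (R : realFieldType) (I : finType) (P : pred I) (a : I -> R) :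
  (\sum_(i | P i) a i) ^+ 2 <= #|I|%:R * \sum_(i | P i) a i ^+ 2.
Proof.
rewrite [X in X ^+ 2]big_mkcond [in leRHS]big_mkcond /=.
set b := fun i => if P i then a i else 0.
have -> : \sum_i (if P i then a i ^+ 2 else 0) = \sum_i b i ^+ 2.
  by apply: eq_bigr => i _; rewrite /b; case: (P i); rewrite ?expr0n.
rewrite -[X in X ^+ 2 <= _]/(\sum_i b i); set S := \sum_i b i.
have [/eqP N0|N0] := eqVneq #|I| 0%N.
  rewrite /S big_pred0 ?expr0n ?mulr_ge0 ?sumr_ge0// => [i _|i].
    exact: sqr_ge0.
  by have := card0_eq (eqP N0) i; rewrite inE.
have N1 : 0 < #|I|%:R :> R by rewrite ltr0n lt0n.
set c := S / #|I|%:R.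
have : 0 <= \sum_i (b i - c) ^+ 2 by apply: sumr_ge0 => i _; exact: sqr_ge0.
have sqE i : (b i - c) ^+ 2 = b i ^+ 2 + (- (2 * c) * b i + c ^+ 2) by ring.
under eq_bigr do rewrite sqE.
rewrite !big_split /= -mulr_sumr -/S sumr_const -[_ *+ #|I|]mulr_natr => h.
have -> : S ^+ 2 = #|I|%:R * (2 * c * S - c ^+ 2 * #|I|%:R).
  by rewrite /c; field; rewrite gt_eqF.
by rewrite ler_pM2l//; lra.
Qed.

(** The bound on the distance to the limit comes from summing the geometric
tail. *)
Lemma geometric_cauchy (R : realType) (u : R^nat) (C q : R) :
  0 <= C -> 0 <= q < 1 -> (forall N, `|u N.+1 - u N| <= C * q ^+ N) ->
  cvgn u /\ forall N, `|limn u - u N| <= C / (1 - q) * q ^+ N.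
Proof.
move=> C0 /andP[q0 q1] uC.
have q1' : 0 < 1 - q by rewrite subr_gt0.
have bound N k : `|u (N + k)%N - u N| <= C / (1 - q) * q ^+ N * (1 - q ^+ k).
  elim: k => [|k IH]; first by rewrite addn0 !subrr normr0 mulr0.
  rewrite addnS -(subrKA (u (N + k)%N)).
  apply: (le_trans (ler_normD _ _)).
  apply: (le_trans (lerD (uC _) IH)); rewrite exprD exprS.
  by rewrite le_eqVlt; apply/orP; left; apply/eqP; field; rewrite gt_eqF.
have bound' N k : `|u (N + k)%N - u N| <= C / (1 - q) * q ^+ N.
  apply: (le_trans (bound N k)); rewrite ler_piMr//.
    by rewrite mulr_ge0 ?divr_ge0 ?exprn_ge0// ltW.
  by rewrite gerBl exprn_ge0.
have cu : cvgn u.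
  have -> : u = (fun N => u 0%N + series (telescope u) N).
    by apply/funext => N; exact: eq_sum_telescope.
  apply: is_cvgD; first exact: is_cvg_cst.
  apply: normed_cvg; apply: (@series_le_cvg _ _ (fun N => C * q ^+ N)).
  - by move=> N; exact: normr_ge0.
  - by move=> N; rewrite mulr_ge0// exprn_ge0.
  - exact: uC.
  - by apply: is_cvg_geometric_series; rewrite ger0_norm.
split=> // N.
have cuN : `|u (k + N)%N - u N| @[k --> \oo] --> `|limn u - u N|.
  apply: cvg_norm; apply: cvgB; last exact: cvg_cst.
  by rewrite (cvg_shiftn N u).
apply: (ler_cvg_to cuN (cvg_cst (C / (1 - q) * q ^+ N))).
by apply: nearW => k; rewrite addnC; exact: bound'.
Qed.

Lemma opp_level (k : int) (N : nat) : (absz k <= N)%N ->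
  - N%:Z = k - (absz (k + N%:Z))%:Z.
Proof. by lia. Qed.

Section martingale.
Context {R : realType} {n : nat}.
Implicit Types (Q : dyadic_cube n) (e b : {ffun 'I_n -> bool}) (k : int).
Implicit Types (x : n.-tuple R) (f g : n.-tuple R -> R).
Local Notation mu := (@lebesgue_tuple R n).

(** The squared norm of the component of f along the Haar functions of Q. *)
Definition haar_energy f Q : R :=
  \sum_(e | e != [ffun=> true]) inner f (haar Q e) ^+ 2.

(** The conditional expectation of f on the cubes of level k. *)
Definition mean_at f k x : R := cube_mean f (cube_at k x).

Lemma haar_energy_ge0 f Q : 0 <= haar_energy f Q.
Proof. by apply: sumr_ge0 => e _; exact: sqr_ge0. Qed.

Lemma cube_mean_child_sqr f Q b : cube_integrable f ->
  (cube_mean f (child Q b) - cube_mean f Q) ^+ 2 <=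
  2 ^+ n * haar_energy f Q / cube_volume Q.
Proof.
move=> fi; rewrite cube_mean_child// exprMn haar_norm_sqr mulrC.
rewrite ler_pM2r ?invr_gt0 ?cube_volume_gt0//.
apply: (le_trans (sqr_sum_le _ _)).
rewrite card_ffun card_bool card_ord natrX.
apply: ler_wpM2l; first by rewrite exprn_ge0.
by apply: ler_sum => e _; rewrite exprMn child_sign_sqr mulr1.
Qed.

Lemma cube_at_child k x : exists b, cube_at (k - 1) x = child (cube_at k x) b.
Proof.
have /cube_set_child[b xb] := cube_set_at k x.
by exists b; move/cube_setP: xb.
Qed.

Lemma mean_at_step f k x : cube_integrable f ->
  (mean_at f (k - 1) x - mean_at f k x) ^+ 2 <=
  2 ^+ n * haar_energy f (cube_at k x) / (2 ^+ n) ^ k.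
Proof.
move=> fi; rewrite /mean_at; have [b ->] := cube_at_child k x.
by rewrite -[X in _ / X](cube_volumeE (cube_at k x)); exact: cube_mean_child_sqr.
Qed.

Lemma measurable_mean_at f k : measurable_fun setT (mean_at f k).
Proof. exact: measurable_fun_cube_at. Qed.

(** Cauchy-Schwarz on Q; the bound is uniform in the cubes of one level. *)
Lemma cube_mean_sqr f Q : f \in Lfun mu 2%:E ->
  cube_mean f Q ^+ 2 <= \int[mu]_x (f x ^+ 2) / cube_volume Q.
Proof.
move=> f2; have [mf foo] := (Lfun2P mu f).1 f2.
have v0 := cube_volume_gt0 (R := R) Q.
have mQ := measurable_cube (R := R) Q.
have := sqr_Rintegral_le mQ (lebesgue_cube Q) v0 mf (sqr_integrable mQ mf foo).
rewrite -/(cube_int f Q) => h.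
rewrite /cube_mean exprMn -[X in _ * X ^+ 2]mul1r expr_div_n expr1n expr2.
rewrite ler_pdivlMr// (_ : _ * _ = cube_int f Q ^+ 2 / cube_volume Q); last first.
  by field; rewrite gt_eqF.
rewrite ler_pdivrMr// mulrC; apply: (le_trans h); rewrite ler_pM2l//.
rewrite /Rintegral fine_le//.
- exact: (integrable_fin_num mQ (sqr_integrable mQ mf foo)).
- exact: (integrable_fin_num measurableT (sqr_integrable measurableT mf foo)).
- apply: ge0_subset_integral => //.
  by apply/measurable_EFinP; exact: measurable_funX.
  by move=> x _; rewrite lee_fin sqr_ge0.
Qed.

Lemma cube_integrable_bounded g (B : R) :
  measurable_fun setT g -> (forall x, `|g x| <= B) -> cube_integrable g.
Proof.
move=> mg gB Q; apply: measurable_bounded_integrable.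
- exact: measurable_cube.
- exact: lebesgue_cube_lty.
- exact: measurable_funTS.
- exists B; split; first exact: num_real.
  by move=> c Bc x _; apply: (le_trans (gB x)); exact: ltW.
Qed.

Lemma mean_at_bounded f k : f \in Lfun mu 2%:E ->
  exists B : R, forall x, `|mean_at f k x| <= B.
Proof.
move=> f2; exists (Num.sqrt (\int[mu]_x (f x ^+ 2) / (2 ^+ n) ^ k)) => x.
rewrite -sqrtr_sqr ler_wsqrtr//.
by rewrite -(cube_volumeE (cube_at k x)); exact: cube_mean_sqr.
Qed.

Lemma cube_integrable_mean_at f k : f \in Lfun mu 2%:E ->
  cube_integrable (mean_at f k).
Proof.
move=> f2; have [B fB] := mean_at_bounded k f2.
exact: cube_integrable_bounded (measurable_mean_at f k) fB.
Qed.

Lemma cube_int_const Q g (c : R) : (forall x, cube_set Q x -> g x = c) ->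
  cube_int g Q = c * cube_volume Q.
Proof.
move=> gc; rewrite /cube_int (@eq_Rintegral _ _ _ mu _ (cst c)); last first.
  by move=> x /set_mem /gc.
by rewrite Rintegral_cst//; exact: measurable_cube.
Qed.

(** The tower property of conditional expectations, by induction on the number
of levels between Q and the finer level. *)
Lemma cube_int_mean_at f (j : nat) Q : f \in Lfun mu 2%:E ->
  cube_int (mean_at f (Q.1 - j%:Z)) Q = cube_int f Q.
Proof.
move=> f2; have fi := cube_integrable_L2 f2.
elim: j Q => [|j IH] Q.
  rewrite subr0 (@cube_int_const Q _ (cube_mean f Q)); last first.
    by move=> x /cube_setP Qx; rewrite /mean_at Qx.
  by rewrite /cube_mean divfK// gt_eqF// cube_volume_gt0.
rewrite cube_int_child; last exact: cube_integrable_mean_at.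
rewrite [RHS]cube_int_child//; apply: eq_bigr => b _.
by rewrite -IH /= -addn1 PoszD opprD addrA addrAC.
Qed.

(** The Sobolev embedding. Since 2^n < w the steps of the martingale decay
geometrically towards fine levels, so that it converges uniformly. The limit has
the same integrals over cubes as f by [cube_int_mean_at] and hence equals f
almost everywhere. The averages of level 0 are bounded because f is in L^2. *)
Lemma ae_bounded_cvg f (w M : R) : f \in Lfun mu 2%:E -> 2 ^+ n < w ->
  (forall Q, haar_energy f Q <= M * w ^ Q.1) ->
  exists2 B : R, 0 <= B & {ae mu, forall x, `|f x| <= B /\
    mean_at f (- N%:Z) x @[N --> \oo] --> f x}.
Proof.
move=> f2 vw fM; have fi := cube_integrable_L2 f2.
have [mf foo] := (Lfun2P mu f).1 f2.
have v0 : 0 < (2 : R) ^+ n by rewrite exprn_gt0.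
have w0 : 0 < w by exact: lt_trans vw.
have M0 : 0 <= M.
  have := le_trans (haar_energy_ge0 _ _) (fM (0, [ffun=> 0])).
  by rewrite /= expr0z mulr1.
pose q : R := Num.sqrt (2 ^+ n / w); pose C : R := Num.sqrt (2 ^+ n * M).
have q01 : 0 <= q < 1.
  by rewrite sqrtr_ge0 /= -[ltRHS]sqrtr1 ltr_sqrt// ltr_pdivrMr// mul1r vw.
have q1 : 0 < 1 - q by case/andP: q01; rewrite subr_gt0.
have C0 : 0 <= C by exact: sqrtr_ge0.
have step x N : `|mean_at f (- N.+1%:Z) x - mean_at f (- N%:Z) x| <= C * q ^+ N.
  rewrite -ler_sqr ?nnegrE ?mulr_ge0 ?exprn_ge0//; last by case/andP: q01.
  rewrite real_normK ?num_real// exprMn -exprM mulnC exprM !sqr_sqrtr; last 2 first.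
    by rewrite divr_ge0// ltW.
    by rewrite mulr_ge0// ltW.
  rewrite -addn1 PoszD opprD; apply: (le_trans (mean_at_step _ _ fi)).
  have := fM (cube_at (- N%:Z) x); rewrite /= -!exprnN invrK => h.
  have -> : 2 ^+ n * M * (2 ^+ n / w) ^+ N = 2 ^+ n * (M * w ^- N) * (2 ^+ n) ^+ N.
    by rewrite expr_div_n; ring.
  by rewrite ler_pM2r ?exprn_gt0// ler_pM2l.
have cG x := geometric_cauchy C0 q01 (step x).
pose G x := limn (fun N => mean_at f (- N%:Z) x).
have cvgG x : mean_at f (- N%:Z) x @[N --> \oo] --> G x by exact: (cG x).1.
have distG x N : `|G x - mean_at f (- N%:Z) x| <= C / (1 - q) * q ^+ N.
  exact: (cG x).2.
have mG : measurable_fun setT G.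
  apply: (measurable_fun_cvg (fun N => measurable_mean_at f (- N%:Z))) => x _.
  exact: cvgG.
have [B0 fB0] := mean_at_bounded 0 f2.
pose B := C / (1 - q) + B0.
have GB x : `|G x| <= B.
  rewrite -[G x](subrK (mean_at f 0 x)); apply: (le_trans (ler_normD _ _)).
  by apply: lerD => //; have := distG x 0%N; rewrite oppr0 expr0 mulr1.
have Gi := cube_integrable_bounded mG GB.
have fG Q : cube_int f Q = cube_int G Q.
  apply/eqP; rewrite -subr_eq0 -normr_le0; apply/ler_addgt0Pr => eps eps0.
  rewrite add0r.
  (* The level -N has to be fine enough for eps and at least as fine as Q. *)
  have [N [j [QN hN]]] : exists N j : nat, - N%:Z = Q.1 - j%:Z /\
      C / (1 - q) * q ^+ N * cube_volume Q <= eps.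
    have qN : q ^+ N @[N --> \oo] --> 0.
      by apply: cvg_expr; case/andP: q01 => *; rewrite ger0_norm.
    have cN : C / (1 - q) * q ^+ N * cube_volume Q @[N --> \oo] --> 0.
      rewrite -[X in _ --> X](mul0r (cube_volume Q)) -(mulr0 (C / (1 - q))).
      by apply: cvgM; [apply: cvgM => //|]; exact: cvg_cst.
    have [N0 _ hN0] := cvgr_le _ cN eps eps0.
    exists (maxn N0 (absz Q.1)), (absz (Q.1 + (maxn N0 (absz Q.1))%:Z)); split.
      by apply: opp_level; exact: leq_maxr.
    by apply: hN0; exact: leq_maxl.
  rewrite -(cube_int_mean_at j Q f2) -QN -RintegralB; last 3 first.
  - exact: measurable_cube.
  - exact: cube_integrable_mean_at.
  - exact: Gi.
  have mQ := measurable_cube (R := R) Q.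
  have iD := integrableB mQ (cube_integrable_mean_at (- N%:Z) f2 Q) (Gi Q).
  apply: (le_trans (le_normr_Rintegral mQ iD)).
  apply: le_trans hN.
  have -> : C / (1 - q) * q ^+ N * cube_volume Q =
      \int[mu]_(x in cube_set Q) (C / (1 - q) * q ^+ N).
    by rewrite Rintegral_cst.
  apply: le_Rintegral => //.
  - exact: integrable_abse iD.
  - exact: integrable_cst_lty (lebesgue_cube_lty _).
  - by move=> x _; rewrite distrC.
have aefG := ae_eq_of_cube_int mf mG fi Gi fG.
exists B; first exact: le_trans (normr_ge0 _) (GB [tuple of nseq n 0]).
by apply: filterS aefG => x ->; split; [exact: GB|exact: cvgG].
Qed.

End martingale.

(** * The Sobolev sum, level by level *)

Section esum_facts.
Context {R : realType}.

Lemma esum_le1 (T : choiceType) (I : set T) (a : T -> \bar R) t :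
  I t -> (0 <= a t)%E -> (a t <= \esum_(i in I) a i)%E.
Proof.
move=> It a0; apply: esum_ge; exists [set t]; last by rewrite fsbig_set1.
by split; [exact: finite_set1|move=> _ ->].
Qed.

Lemma esumZ_le (T : choiceType) (I : set T) (a : T -> \bar R) (c : R) :
  0 <= c -> (forall i, I i -> (0 <= a i)%E) ->
  (\esum_(i in I) (c%:E * a i) <= c%:E * \esum_(i in I) a i)%E.
Proof.
move=> c0 a0; apply: ge_ereal_sup => _ [X [finX XI] <-].
have -> : (\sum_(i \in X) (c%:E * a i) = c%:E * \sum_(i \in X) a i)%E.
  rewrite !fsbig_finite//= big_seq [in RHS]big_seq ge0_sume_distrr// => i.
  by rewrite in_fset_set// inE => /XI /a0.
by apply: lee_wpmul2l; rewrite ?lee_fin//; apply: esum_ge; exists X.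
Qed.

(** Apply [esumZ_le] with c and with its inverse. *)
Lemma esumZ (T : choiceType) (I : set T) (a : T -> \bar R) (c : R) :
  0 < c -> (forall i, I i -> (0 <= a i)%E) ->
  (\esum_(i in I) (c%:E * a i) = c%:E * \esum_(i in I) a i)%E.
Proof.
move=> c0 a0; apply/eqP; rewrite eq_le (esumZ_le (ltW c0) a0) /=.
have cK (u : \bar R) : (c^-1%:E * (c%:E * u) = u)%E.
  by rewrite muleA -EFinM mulVf ?mul1e// gt_eqF.
have ca0 i : I i -> (0 <= c%:E * a i)%E.
  by move=> Ii; apply: mule_ge0; [rewrite lee_fin ltW|exact: a0].
have c10 : 0 <= c^-1 by rewrite invr_ge0 ltW.
have := esumZ_le c10 ca0; under eq_esum do rewrite cK.
move=> h; apply: (le_trans (lee_wpmul2l _ h)).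
  by rewrite lee_fin ltW.
by rewrite muleA -EFinM divff ?mul1e// gt_eqF.
Qed.

Lemma esum_fin (I : finType) (P : pred I) (a : I -> R) :
  (forall i, P i -> 0 <= a i) ->
  (\esum_(i in [set` P]) (a i)%:E = (\sum_(i | P i) a i)%:E)%E.
Proof.
move=> a0; rewrite esum_fset; last first.
- by move=> i; rewrite inE /= => Pi; rewrite lee_fin a0.
- exact: finite_finset.
rewrite -sumEFin (bigfs _ (index_enum_uniq _))// => i _.
by rewrite mem_index_enum.
Qed.

End esum_facts.

Section sobolev_sum.
Context {R : realType} {n : nat}.
Implicit Types (Q : dyadic_cube n) (e b : {ffun 'I_n -> bool}) (k : int).
Implicit Types (x : n.-tuple R) (f g : n.-tuple R -> R).
Local Notation mu := (@lebesgue_tuple R n).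

Definition level_energy f k : \bar R :=
  \esum_(m in [set: {ffun 'I_n -> int}]) (haar_energy f (k, m))%:E.

Lemma level_energy_ge0 f k : (0 <= level_energy f k)%E.
Proof. by apply: esum_ge0 => m _; rewrite lee_fin haar_energy_ge0. Qed.

(** The parameter w stands for 2^(2s), so that w^(-k) is the weight of the cubes
of level k. *)
Definition sobolev_sum (w : R) f : \bar R :=
  \esum_(k in [set: int]) ((w ^ (- k))%:E * level_energy f k)%E.

Lemma sobolev_weight (s : R) Q : (0 < n)%N ->
  cube_volume Q `^ (- (2 * s / n%:R)) = (2 `^ (2 * s)) ^ (- Q.1) :> R.
Proof.
move=> n0; have h2 : 0 <= 2 :> R := ler0n _ 2.
have hn : 0 <= 2 ^+ n :> R := exprn_ge0 n h2.
have hs : 0 <= 2 `^ (2 * s) :> R := powR_ge0 _ _.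
rewrite cube_volumeE -(powR_intmul _ hn) -(powR_intmul _ hs).
rewrite -(powR_mulrn n h2) -!powRrM; congr (_ `^ _).
by rewrite intrN; field; rewrite pnatr_eq0 -lt0n.
Qed.

(** Sum over e, then over the cubes of one level, then over the levels. *)
Lemma esum_haar (s : R) f : (0 < n)%N ->
  (\esum_(j in haar_indices)
    (cube_volume j.1 `^ (- (2 * s / n%:R)) *
     `|inner f (haar j.1 j.2)| ^+ 2)%:E =
   sobolev_sum (2 `^ (2 * s)) f)%E.
Proof.
move=> n0; set w := 2 `^ (2 * s).
have w0 k : 0 <= w ^ k by rewrite exprz_ge0// powR_ge0.
pose a Q e := (w ^ (- Q.1) * inner f (haar Q e) ^+ 2)%:E.
have a0 Q e : (0 <= a Q e)%E by rewrite lee_fin mulr_ge0// sqr_ge0.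
pose E : set {ffun 'I_n -> bool} := [set` [pred e | e != [ffun=> true]]].
transitivity (\esum_(j in [set: dyadic_cube n] `*`` (fun=> E)) a j.1 j.2).
  have -> : haar_indices = [set: dyadic_cube n] `*`` (fun=> E).
    by apply/seteqP; split => -[Q e] /=; [move=> /eqP|move=> [_] /eqP].
  apply: eq_esum => -[Q e] _.
  by rewrite /a /= sobolev_weight// real_normK// num_real.
rewrite -esum_esum; last by [].
pose M := [set: {ffun 'I_n -> int}].
transitivity (\esum_(Q in [set: int] `*`` (fun=> M))
    ((w ^ (- Q.1)) * haar_energy f (Q.1, Q.2))%:E).
  have -> : [set: dyadic_cube n] = [set: int] `*`` (fun=> M).
    by apply/seteqP; split.
  apply: eq_esum => -[k m] _.
  rewrite esum_fin; last by move=> e _; rewrite mulr_ge0// sqr_ge0.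
  by rewrite -mulr_sumr.
rewrite -(@esum_esum _ _ _ _ _ (fun k m => (w ^ (- k) * haar_energy f (k, m))%:E)).
  apply: eq_esum => k _; under eq_esum do rewrite EFinM.
  rewrite esumZ//; first by rewrite exprz_gt0// powR_gt0.
  by move=> m _; rewrite lee_fin haar_energy_ge0.
by move=> k m _ _; rewrite lee_fin mulr_ge0// haar_energy_ge0.
Qed.

End sobolev_sum.

(** * Deviation from the averages *)

Lemma esum_exchange (R : realType) (T1 T2 : choiceType)
    (a : T1 -> T2 -> \bar R) : (forall i j, (0 <= a i j)%E) ->
  (\esum_(i in [set: T1]) \esum_(j in [set: T2]) a i j =
   \esum_(j in [set: T2]) \esum_(i in [set: T1]) a i j)%E.
Proof.
move=> a0; rewrite !esum_esum//.
rewrite (@reindex_esum _ _ _ ([set: T2] `*`` (fun=> [set: T1]))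
  ([set: T1] `*`` (fun=> [set: T2])) (fun k => (k.2, k.1)))//.
split.
- by move=> k _.
- by move=> [i j] [i' j'] _ _ [-> ->].
- by move=> [i j] _; exists (j, i).
Qed.

Lemma geometric_nneseries_lty (R : realType) (c r : R) :
  0 <= c -> 0 <= r < 1 -> (\sum_(i <oo) (c * r ^+ i)%:E < +oo)%E.
Proof.
move=> c0 /andP[r0 r1]; have r1' : 0 < 1 - r by rewrite subr_gt0.
apply: (@le_lt_trans _ _ (c / (1 - r))%:E); last exact: ltry.
apply: lime_le.
  by apply: is_cvg_nneseries => i _ _; rewrite lee_fin mulr_ge0// exprn_ge0.
apply: nearW => N; rewrite sumEFin lee_fin.
have -> : \sum_(0 <= i < N) c * r ^+ i = c / (1 - r) * (1 - r ^+ N).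
  elim: N => [|N IH]; first by rewrite big_nil subrr mulr0.
  by rewrite big_nat_recr//= IH exprS; field; rewrite gt_eqF.
by apply: ler_piMr; [exact: divr_ge0 (ltW r1')|rewrite gerBl exprn_ge0].
Qed.

(** Iterate (x + y)^2 <= th x^2 + th / (th - 1) y^2, splitting off the first
step each time. For th close to 1 this costs an arbitrarily small exponential
loss. *)
Lemma sqr_telescope_le (R : realFieldType) (th : R) (a : nat -> R) N : 1 < th ->
  (a N - a 0%N) ^+ 2 <=
  th / (th - 1) * \sum_(0 <= i < N) th ^+ i * (a i.+1 - a i) ^+ 2.
Proof.
move=> th1; have th0 : 0 < th - 1 by rewrite subr_gt0.
elim: N a => [|N IH] a; first by rewrite subrr expr0n big_nil mulr0.
(* The difference of the two sides is ((th - 1) u - v)^2 / (th - 1). *)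
have young (u v : R) : (u + v) ^+ 2 <= th * u ^+ 2 + th / (th - 1) * v ^+ 2.
  rewrite -subr_ge0.
  have -> : th * u ^+ 2 + th / (th - 1) * v ^+ 2 - (u + v) ^+ 2 =
    ((th - 1) * u - v) ^+ 2 / (th - 1) by field; rewrite gt_eqF.
  by rewrite divr_ge0 ?sqr_ge0// ltW.
rewrite -(subrKA (a 1%N)); apply: (le_trans (young _ _)).
rewrite big_nat_recl//= mulrDr expr0 mul1r addrC lerD2l.
apply: (le_trans (ler_wpM2l _ (IH (fun i => a i.+1)))).
  by apply: ltW; apply: lt_trans th1.
rewrite mulrCA ler_pM2l ?divr_gt0//; last exact: lt_trans th1.
rewrite mulr_sumr; apply: ler_sum => i _.
by rewrite [th ^+ i.+1]exprS mulrA.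
Qed.

Section deviation.
Context {R : realType} {n : nat}.
Implicit Types (Q : dyadic_cube n) (k : int).
Implicit Types (x : n.-tuple R) (f g : n.-tuple R -> R).
Local Notation mu := (@lebesgue_tuple R n).

(** Up to the factor 2^n, the bound of [mean_at_step] on the square of a step of
the martingale. *)
Definition step_energy f k x : R :=
  haar_energy f (cube_at k x) / (2 ^+ n) ^ k.

Lemma step_energy_ge0 f k x : 0 <= step_energy f k x.
Proof. by rewrite divr_ge0 ?haar_energy_ge0// exprz_ge0// exprn_ge0. Qed.

Lemma measurable_step_energy f k : measurable_fun setT (step_energy f k).
Proof.
apply: measurable_funM; last exact: measurable_cst.
exact: measurable_fun_cube_at.
Qed.

Lemma integral_step_energy f k :
  (\int[mu]_x (step_energy f k x)%:E = level_energy f k)%E.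
Proof.
rewrite (ge0_integral_cubes k); last 2 first.
- by apply/measurable_EFinP; exact: measurable_step_energy.
- by move=> x; rewrite lee_fin step_energy_ge0.
apply: eq_esum => m _.
rewrite (eq_integral (cst (haar_energy f (k, m) / (2 ^+ n) ^ k)%:E)); last first.
  by move=> x /set_mem/cube_setP /= xm; rewrite /step_energy xm.
rewrite integral_cst; last exact: measurable_cube.
rewrite [X in (_ * X)%E](lebesgue_cube (k, m)) cube_volumeE -EFinM divfK//=.
by rewrite expfz_neq0// expf_neq0.
Qed.

(** Only the levels tending to -oo matter, so the starting level is free. *)
Lemma cvg_mean_at f k x : mean_at f (- N%:Z) x @[N --> \oo] --> f x ->
  mean_at f (k - N%:Z) x @[N --> \oo] --> f x.
Proof.
case: k => p cf.
  rewrite -(cvg_shiftn p).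
  have -> : (fun N => mean_at f (Posz p - (N + p)%N%:Z) x) =
    (fun N => mean_at f (- N%:Z) x); last by [].
  by apply/funext => N; congr (mean_at f _ x); lia.
have -> : (fun N => mean_at f (Negz p - N%:Z) x) =
    (fun N => mean_at f (- (N + p.+1)%N%:Z) x).
  by apply/funext => N; congr (mean_at f _ x); lia.
by rewrite (cvg_shiftn p.+1 (fun N => mean_at f (- N%:Z) x)).
Qed.

(** Telescope from level k down to level k - N and let N tend to infinity. *)
Lemma sqr_deviation_le f k x (th : R) : cube_integrable f -> 1 < th ->
  mean_at f (- N%:Z) x @[N --> \oo] --> f x ->
  (((f x - mean_at f k x) ^+ 2)%:E <=
   \sum_(i <oo) (th / (th - 1) * 2 ^+ n * th ^+ i *
                 step_energy f (k - i%:Z) x)%:E)%E.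
Proof.
move=> fi th1 /(cvg_mean_at k) cf.
have th0 : 0 < th - 1 by rewrite subr_gt0.
have th00 : 0 < th by exact: lt_trans th1.
have c0 : 0 <= th / (th - 1) by rewrite divr_ge0// ltW.
pose c i := th / (th - 1) * 2 ^+ n * th ^+ i * step_energy f (k - i%:Z) x.
have ci0 i : 0 <= c i.
  rewrite /c mulr_ge0 ?step_energy_ge0// mulr_ge0 ?(exprn_ge0 _ (ltW th00))//.
  by rewrite mulr_ge0// exprn_ge0.
have part N : (((mean_at f (k - N%:Z) x - mean_at f k x) ^+ 2)%:E <=
    \sum_(i <oo) (c i)%:E)%E.
  apply: le_trans (nneseries_lim_ge N _); last by move=> i _ _; rewrite lee_fin.
  rewrite sumEFin lee_fin.
  have := sqr_telescope_le (fun i => mean_at f (k - i%:Z) x) N th1.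
  rewrite subr0 => /le_trans; apply.
  rewrite mulr_sumr; apply: ler_sum => i _.
  have -> : c i = th / (th - 1) *
      (th ^+ i * (2 ^+ n * step_energy f (k - i%:Z) x)) by rewrite /c; ring.
  apply: (ler_wpM2l c0); apply: ler_wpM2l; first exact: exprn_ge0 (ltW th00).
  by rewrite -addn1 PoszD opprD addrA mulrA; exact: mean_at_step.
have : (0 <= \sum_(i <oo) (c i)%:E)%E.
  by apply: nneseries_ge0 => i _ _; rewrite lee_fin.
move: part; rewrite -/c; case: (\sum_(i <oo) (c i)%:E)%E => [S|_ _|//].
  move=> part _; rewrite lee_fin.
  have cf2 : (mean_at f (k - N%:Z) x - mean_at f k x) ^+ 2 @[N --> \oo] -->
      (f x - mean_at f k x) ^+ 2.
    rewrite expr2; under eq_fun do rewrite expr2.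
    by apply: cvgM; apply: cvgB => //; exact: cvg_cst.
  apply: (ler_cvg_to cf2 (cvg_cst S)).
  by apply: nearW => N; rewrite -lee_fin.
exact: leey.
Qed.

Lemma integral_deviation_le f k (th : R) : f \in Lfun mu 2%:E -> 1 < th ->
  {ae mu, forall x, mean_at f (- N%:Z) x @[N --> \oo] --> f x} ->
  (\int[mu]_x ((f x - mean_at f k x) ^+ 2)%:E <=
   \sum_(i <oo) (th / (th - 1) * 2 ^+ n * th ^+ i)%:E *
                level_energy f (k - i%:Z))%E.
Proof.
move=> f2 th1 aef; have [mf _] := (Lfun2P mu f).1 f2.
have fi := cube_integrable_L2 f2.
have th0 : 0 < th - 1 by rewrite subr_gt0.
have th00 : 0 < th by exact: lt_trans th1.
pose c i := th / (th - 1) * 2 ^+ n * th ^+ i.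
have c0 i : 0 <= c i.
  rewrite /c mulr_ge0 ?(exprn_ge0 _ (ltW th00))// mulr_ge0 ?exprn_ge0//.
  by rewrite divr_ge0// ltW.
pose h i x := ((c i)%:E * (step_energy f (k - i%:Z) x)%:E)%E.
have h0 i x : (0 <= h i x)%E by rewrite mule_ge0 ?lee_fin// step_energy_ge0.
have mh i : measurable_fun setT (h i).
  apply: emeasurable_funM; first exact: measurable_cst.
  by apply/measurable_EFinP; exact: measurable_step_energy.
have <- : (\int[mu]_x \sum_(i <oo) h i x =
    \sum_(i <oo) (c i)%:E * level_energy f (k - i%:Z))%E.
  rewrite integral_nneseries//; apply: eq_eseriesr => i _.
  rewrite ge0_integralZl//; last 3 first.
  - by apply/measurable_EFinP; exact: measurable_step_energy.
  - by move=> x _; rewrite lee_fin step_energy_ge0.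
  - by rewrite lee_fin.
  by rewrite integral_step_energy.
apply: ae_ge0_le_integral => //.
- by move=> x _; rewrite lee_fin sqr_ge0.
- apply/measurable_EFinP; apply: measurable_funX; apply: measurable_funB => //.
  exact: measurable_mean_at.
- by move=> x _; apply: nneseries_ge0 => i _ _; exact: h0.
- apply: ge0_emeasurable_sum => //.
apply: filterS aef => x cf _; apply: (le_trans (sqr_deviation_le k fi th1 cf)).
apply: lee_nneseries => // i _ _.
by rewrite lee_fin; exact: mulr_ge0 (c0 i) (step_energy_ge0 _ _ _).
Qed.

(** With th = (1 + w) / 2, exchanging the sums over k and i and shifting k by i
leaves a geometric series in th / w times the Sobolev sum of f. *)
Lemma deviation_sum_lty f (w : R) : f \in Lfun mu 2%:E -> 1 < w ->
  {ae mu, forall x, mean_at f (- N%:Z) x @[N --> \oo] --> f x} ->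
  (sobolev_sum w f < +oo)%E ->
  (\esum_(k in [set: int])
     ((w ^ (- k))%:E * \int[mu]_x ((f x - mean_at f k x) ^+ 2)%:E) < +oo)%E.
Proof.
move=> f2 w1 aef fS; pose th := (1 + w) / 2.
have th1 : 1 < th by rewrite /th; lra.
have thw : th < w by rewrite /th; lra.
have th0 : 0 < th - 1 by rewrite subr_gt0.
have th00 : 0 < th by exact: lt_trans th1.
have w0 : 0 < w by exact: lt_trans w1.
pose c i := th / (th - 1) * 2 ^+ n * th ^+ i.
have c0 i : 0 < c i.
  by rewrite /c mulr_gt0 ?exprn_gt0// mulr_gt0 ?exprn_gt0// divr_gt0.
have wk k : 0 < w ^ k by rewrite exprz_gt0.
pose a k i := ((w ^ (- k))%:E * ((c i)%:E * level_energy f (k - i%:Z)))%E.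
have cT0 i k : (0 <= (c i)%:E * level_energy f k)%E.
  by rewrite mule_ge0 ?level_energy_ge0// lee_fin ltW.
have a0 k i : (0 <= a k i)%E by rewrite mule_ge0// lee_fin ltW.
apply: (@le_lt_trans _ _
    (\esum_(k in [set: int]) \esum_(i in [set: nat]) a k i)%E).
  apply: le_esum => k _; rewrite esumZ// -nneseries_esumT//.
  apply: lee_wpmul2l; first by rewrite lee_fin ltW.
  exact: integral_deviation_le.
rewrite esum_exchange//.
have S0 : (0 <= sobolev_sum w f)%E.
  by apply: esum_ge0 => k _; rewrite mule_ge0 ?level_energy_ge0// lee_fin ltW.
have col i : (\esum_(k in [set: int]) a k i =
    (c i * w ^- i)%:E * sobolev_sum w f)%E.
  rewrite (@reindex_esum _ _ _ [set: int] [set: int] (fun k => k + i%:Z)).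
    rewrite -esumZ; last 2 first.
    - by rewrite mulr_gt0// invr_gt0 exprn_gt0.
    - by move=> k _; rewrite mule_ge0 ?level_energy_ge0// lee_fin ltW.
    apply: eq_esum => k _; rewrite /a addrK !muleA -!EFinM; congr (_%:E * _)%E.
    by rewrite opprD expfzDr ?gt_eqF// -exprnN; ring.
  split => // [k l _ _ /addIr //|k _].
  by exists (k - i%:Z) => //; rewrite subrK.
under eq_esum do rewrite col.
rewrite -(fineK (x := sobolev_sum w f)); last by rewrite ge0_fin_numE.
set S := fine _; have S0' : 0 <= S by exact: fine_ge0.
rewrite -nneseries_esumT; last first.
  move=> i; rewrite -EFinM lee_fin; apply: mulr_ge0 => //.
  exact: divr_ge0 (ltW (c0 i)) (exprn_ge0 _ (ltW w0)).
rewrite (eq_eseriesr (g := fun i =>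
    (th / (th - 1) * 2 ^+ n * S * (th / w) ^+ i)%:E)); last first.
  move=> i _; rewrite -EFinM; congr EFin; rewrite expr_div_n /c; ring.
apply: geometric_nneseries_lty.
  by rewrite mulr_ge0// mulr_ge0 ?exprn_ge0// divr_ge0// ltW.
by rewrite (divr_ge0 (ltW th00) (ltW w0)) ltr_pdivrMr// mul1r.
Qed.

End deviation.

(** * Products for s > n/2 *)

Lemma ltr_powR2 (R : realType) (x y : R) : x < y -> 2 `^ x < 2 `^ y.
Proof.
move=> xy; rewrite /powR !gt_eqF// ltr_expR ltr_pM2r//.
by rewrite ln_gt0// ltr1n.
Qed.

Section algebra.
Context {R : realType} {n : nat}.
Implicit Types (Q : dyadic_cube n) (k : int).
Implicit Types (x : n.-tuple R) (f g : n.-tuple R -> R).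
Local Notation mu := (@lebesgue_tuple R n).

Lemma dyadic_sobolevP (s : R) f : (0 < n)%N ->
  dyadic_sobolev n s f <->
  f \in Lfun mu 2%:E /\ (sobolev_sum (2 `^ (2 * s)) f < +oo)%E.
Proof. by move=> n0; rewrite /dyadic_sobolev /= esum_haar. Qed.

(** Square-integrability and all integrals over cubes depend only on the class
of f almost everywhere, and they determine the Haar coefficients. *)
Lemma dyadic_sobolev_ae (s : R) f g : (0 < n)%N -> measurable_fun setT g ->
  {ae mu, forall x, f x = g x} -> dyadic_sobolev n s f -> dyadic_sobolev n s g.
Proof.
move=> n0 mg fg /(dyadic_sobolevP s f n0)[f2 fs].
apply/(dyadic_sobolevP s g n0).
have [mf foo] := (Lfun2P mu f).1 f2.
have g2 : g \in Lfun mu 2%:E.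
  apply/Lfun2P; split => //.
  rewrite -(@ge0_ae_eq_integral _ _ _ _ _ (fun x => (f x ^+ 2)%:E))//.
  - by apply/measurable_EFinP; exact: measurable_funX.
  - by apply/measurable_EFinP; exact: measurable_funX.
  - by move=> x _; rewrite lee_fin sqr_ge0.
  - by move=> x _; rewrite lee_fin sqr_ge0.
  - by apply: filterS fg => x -> _.
split; first exact: g2.
have cfg Q : cube_int f Q = cube_int g Q.
  congr fine; apply: ae_eq_integral.
  - exact: measurable_cube.
  - by apply/measurable_EFinP; exact: measurable_funTS.
  - by apply/measurable_EFinP; exact: measurable_funTS.
  - by apply: filterS fg => x -> _.
have -> : sobolev_sum (2 `^ (2 * s)) g = sobolev_sum (2 `^ (2 * s)) f;
  last exact: fs.
apply: eq_esum => k _; congr (_ * _)%E; apply: eq_esum => m _; congr EFin.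
apply: eq_bigr => e _; congr (_ ^+ 2).
rewrite !inner_haar; [|exact: cube_integrable_L2..].
by congr (_ * _); apply: eq_bigr => b _; rewrite cfg.
Qed.

(** One term of the Bessel inequality on Q, by Cauchy-Schwarz over the children
and on each of them. *)
Lemma inner_haar_sqr_le f Q (e : {ffun 'I_n -> bool}) (B : R) :
  measurable_fun setT f -> (forall x, `|f x| <= B) ->
  inner f (haar Q e) ^+ 2 <= cube_int (fun x => f x ^+ 2) Q.
Proof.
move=> mf fB.
have fi := cube_integrable_bounded mf fB.
have f2i : cube_integrable (fun x => f x ^+ 2).
  apply: (@cube_integrable_bounded _ _ _ (B ^+ 2)).
    exact: measurable_funX.
  move=> x; rewrite normrX ler_pXn2r ?nnegrE//.
  exact: le_trans (normr_ge0 _) (fB x).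
rewrite inner_haar// exprMn haar_norm_sqr mulrC ler_pdivrMr ?cube_volume_gt0//.
apply: (le_trans (sqr_sum_le _ _)).
rewrite card_ffun card_bool card_ord natrX cube_int_child// mulr_suml mulr_sumr.
apply: ler_sum => b _; rewrite exprMn child_sign_sqr mul1r.
rewrite (cube_volume_child Q b) [leRHS]mulrCA ler_pM2l ?exprn_gt0//.
rewrite [leRHS]mulrC.
have mb := measurable_cube (R := R) (child Q b).
exact: sqr_Rintegral_le mb (lebesgue_cube _) (cube_volume_gt0 _) mf (f2i _).
Qed.

(** With c the average of g over Q, f g = f (g - c) + c f; apply
[inner_haar_sqr_le] to the first term. The average c is bounded like g. *)
Lemma haar_energy_mul f g Q (B : R) :
  measurable_fun setT f -> measurable_fun setT g ->
  (forall x, `|f x| <= B) -> (forall x, `|g x| <= B) ->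
  haar_energy (f \* g) Q <=
  2 * 2 ^+ n * B ^+ 2 * cube_int (fun x => (g x - cube_mean g Q) ^+ 2) Q +
  2 * B ^+ 2 * haar_energy f Q.
Proof.
move=> mf mg fB gB.
have B0 : 0 <= B by exact: le_trans (normr_ge0 _) (fB [tuple of nseq n 0]).
have fi := cube_integrable_bounded mf fB.
have gi := cube_integrable_bounded mg gB.
have mQ := measurable_cube (R := R) Q.
set c := cube_mean g Q.
have cB : `|c| <= B.
  rewrite /c /cube_mean normrM [X in _ * X]ger0_norm; last first.
    by rewrite invr_ge0 ltW// cube_volume_gt0.
  rewrite ler_pdivrMr ?cube_volume_gt0//.
  apply: (le_trans (le_normr_Rintegral mQ (gi Q))).
  rewrite (_ : B * _ = \int[mu]_(x in cube_set Q) B); last first.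
    by rewrite Rintegral_cst// lebesgue_cube.
  apply: le_Rintegral => //.
  - exact: integrable_abse (gi Q).
  - exact: integrable_cst_lty (lebesgue_cube_lty _).
pose F x := f x * (g x - c).
have mF : measurable_fun setT F.
  by apply: measurable_funM => //; apply: measurable_funB.
have FB x : `|F x| <= B * (B + B).
  rewrite normrM ler_pM//; apply: (le_trans (ler_normB _ _)).
  exact: lerD.
have Fi := cube_integrable_bounded mF FB.
have mfg : measurable_fun setT (f \* g) by exact: measurable_funM.
have fgB x : `|(f \* g) x| <= B * B by rewrite normrM ler_pM.
have fgi := cube_integrable_bounded mfg fgB.
have innE e : inner (f \* g) (haar Q e) =
    inner F (haar Q e) + c * inner f (haar Q e).
  rewrite !inner_haar// mulrCA -mulrDr; congr (_ * _).
  rewrite mulr_sumr -big_split; apply: eq_bigr => b _ /=.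
  rewrite mulrCA -mulrDr; congr (_ * _).
  have mb := measurable_cube (R := R) (child Q b).
  rewrite /cube_int -(RintegralZl _ mb (fi _)).
  rewrite -(RintegralD mb (Fi _) (integrableZl mb c (fi _))).
  by apply: eq_Rintegral => x _; rewrite /F /=; ring.
have FQ : cube_int (fun x => F x ^+ 2) Q <=
    B ^+ 2 * cube_int (fun x => (g x - c) ^+ 2) Q.
  have gcB x : `|(g x - c) ^+ 2| <= (B + B) ^+ 2.
    rewrite normrX ler_pXn2r ?nnegrE ?addr_ge0//.
    by apply: (le_trans (ler_normB _ _)); exact: lerD.
  have mgc : measurable_fun setT (fun x => (g x - c) ^+ 2).
    by apply: measurable_funX; exact: measurable_funB.
  have gci := cube_integrable_bounded mgc gcB Q.
  rewrite -(RintegralZl _ mQ gci); apply: le_Rintegral => //.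
  - have F2B x : `|F x ^+ 2| <= (B * (B + B)) ^+ 2.
      by rewrite normrX ler_pXn2r ?nnegrE ?mulr_ge0 ?addr_ge0.
    by apply: (cube_integrable_bounded _ F2B); exact: measurable_funX.
  - exact: (integrableZl mQ (B ^+ 2) gci).
  - move=> x _; rewrite /F exprMn ler_wpM2r ?sqr_ge0//.
    by rewrite -(real_normK (num_real (f x))) ler_pXn2r ?nnegrE.
set D := cube_int (fun x => (g x - c) ^+ 2) Q.
have D0 : 0 <= D by apply: Rintegral_ge0 => x _; exact: sqr_ge0.
have step e : inner (f \* g) (haar Q e) ^+ 2 <=
    2 * B ^+ 2 * D + 2 * B ^+ 2 * inner f (haar Q e) ^+ 2.
  rewrite innE; set u := inner F _; set v := inner f _.
  have uD : u ^+ 2 <= B ^+ 2 * D.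
    exact: le_trans (inner_haar_sqr_le _ _ mF FB) FQ.
  have cv : (c * v) ^+ 2 <= B ^+ 2 * v ^+ 2.
    rewrite exprMn ler_wpM2r ?sqr_ge0//.
    by rewrite -(real_normK (num_real c)) ler_pXn2r ?nnegrE.
  have := sqr_ge0 (u - c * v); rewrite sqrrB sqrrD; lra.
rewrite /haar_energy; apply: (le_trans (ler_sum _ (fun e _ => step e))).
rewrite big_split /= -[X in _ + X <= _]mulr_sumr lerD2r sumr_const.
rewrite -[_ *+ _]mulr_natl.
have -> : 2 * 2 ^+ n * B ^+ 2 * D = 2 ^+ n * (2 * B ^+ 2 * D) by ring.
apply: ler_wpM2r; first by rewrite !mulr_ge0// sqr_ge0.
rewrite -natrX ler_nat; apply: (leq_trans (max_card _)).
by rewrite card_ffun card_bool card_ord.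
Qed.

Lemma level_energy_mul f g k (B : R) : 0 < B ->
  measurable_fun setT f -> measurable_fun setT g ->
  (forall x, `|f x| <= B) -> (forall x, `|g x| <= B) ->
  (level_energy (f \* g)%R k <=
   (2 * 2 ^+ n * B ^+ 2)%:E * (\int[mu]_x ((g x - mean_at g k x) ^+ 2)%:E +
                               level_energy f k))%E.
Proof.
move=> B0 mf mg fB gB; set K := 2 * 2 ^+ n * B ^+ 2.
have K0 : 0 < K by rewrite !mulr_gt0 ?exprn_gt0.
have gi := cube_integrable_bounded mg gB.
have mdev : measurable_fun setT (fun x => (g x - mean_at g k x) ^+ 2).
  by apply: measurable_funX; apply: measurable_funB => //; exact: measurable_mean_at.
rewrite (ge0_integral_cubes k); last 2 first.
- exact/measurable_EFinP.
- by move=> x; rewrite lee_fin sqr_ge0.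
have int0 m : (0 <= \int[mu]_(x in cube_set (k, m))
    ((g x - mean_at g k x) ^+ 2)%:E)%E.
  by apply: integral_ge0 => x _; rewrite lee_fin sqr_ge0.
rewrite -esumD//; last by move=> m _; rewrite lee_fin haar_energy_ge0.
rewrite -esumZ//; last first.
  by move=> m _; rewrite adde_ge0// lee_fin haar_energy_ge0.
apply: le_esum => m _; set Q := (k, m).
have devQ : (\int[mu]_(x in cube_set Q) ((g x - mean_at g k x) ^+ 2)%:E =
    (cube_int (fun x => (g x - cube_mean g Q) ^+ 2) Q)%:E)%E.
  have -> : (\int[mu]_(x in cube_set Q) ((g x - mean_at g k x) ^+ 2)%:E =
      \int[mu]_(x in cube_set Q) ((g x - cube_mean g Q) ^+ 2)%:E)%E.
    by apply: eq_integral => x /set_mem/cube_setP /= xQ; rewrite /mean_at xQ.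
  rewrite /cube_int fineK//; apply: integrable_fin_num.
    exact: measurable_cube.
  have mgc : measurable_fun setT (fun x => (g x - cube_mean g Q) ^+ 2).
    by apply: measurable_funX; exact: measurable_funB.
  apply: (@cube_integrable_bounded _ _ _ ((B + `|cube_mean g Q|) ^+ 2)) => // x.
  rewrite normrX ler_pXn2r ?nnegrE ?addr_ge0 ?(ltW B0)//.
  by apply: (le_trans (ler_normB _ _)); exact: lerD.
rewrite devQ -EFinD -EFinM lee_fin mulrDr.
apply: (le_trans (haar_energy_mul Q mf mg fB gB)); rewrite lerD2l.
apply: ler_wpM2r; first exact: haar_energy_ge0.
have -> : K = 2 * B ^+ 2 * 2 ^+ n by rewrite /K; ring.
apply: ler_peMr; first by rewrite mulr_ge0// sqr_ge0.
by apply: exprn_ege1; rewrite ler1n.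
Qed.

(** Sum the local bound [haar_energy_mul] over all cubes; the deviations of g
are summable by [deviation_sum_lty]. *)
Lemma dyadic_sobolev_mul_bounded (s : R) f g (B : R) : (0 < n)%N ->
  n%:R / 2 < s -> 0 < B ->
  (forall x, `|f x| <= B) -> (forall x, `|g x| <= B) ->
  {ae mu, forall x, mean_at g (- N%:Z) x @[N --> \oo] --> g x} ->
  dyadic_sobolev n s f -> dyadic_sobolev n s g -> dyadic_sobolev n s (f \* g).
Proof.
move=> n0 ns B0 fB gB aeg /(dyadic_sobolevP s f n0)[f2 fs].
move=> /(dyadic_sobolevP s g n0)[g2 gs].
have [mf foo] := (Lfun2P mu f).1 f2; have [mg goo] := (Lfun2P mu g).1 g2.
have n1 : 1 <= n%:R :> R by rewrite ler1n.
set w := 2 `^ (2 * s) in fs gs *.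
have w1 : 1 < w.
  by rewrite -(powRr0 2) /w; apply: ltr_powR2; lra.
have w0 k : 0 < w ^ k by rewrite exprz_gt0// (lt_trans _ w1).
apply/(dyadic_sobolevP s (f \* g) n0); split.
  apply/Lfun2P; split; first exact: measurable_funM.
  apply: (@le_lt_trans _ _ (\int[mu]_x ((B ^+ 2)%:E * (g x ^+ 2)%:E))%E).
    apply: ge0_le_integral => //.
    - by move=> x _; rewrite lee_fin sqr_ge0.
    - by apply/measurable_EFinP; apply: measurable_funX; exact: measurable_funM.
    - apply/measurable_EFinP; apply: measurable_funM => //.
      exact: measurable_funX.
    - move=> x _; rewrite -EFinM lee_fin /= exprMn ler_wpM2r ?sqr_ge0//.
      by rewrite -(real_normK (num_real (f x))) ler_pXn2r ?nnegrE// ltW.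
  rewrite ge0_integralZl_EFin ?sqr_ge0//.
  - by rewrite lte_mul_pinfty// lee_fin sqr_ge0.
  - by move=> x _; rewrite lee_fin sqr_ge0.
  - by apply/measurable_EFinP; exact: measurable_funX.
have dev := deviation_sum_lty g2 w1 aeg gs.
set D := (fun k => \int[mu]_x ((g x - mean_at g k x) ^+ 2)%:E)%E in dev.
have D0 k : (0 <= D k)%E by apply: integral_ge0 => x _; rewrite lee_fin sqr_ge0.
set K := 2 * 2 ^+ n * B ^+ 2.
have K0 : 0 < K by rewrite !mulr_gt0 ?exprn_gt0.
have t1 k : (0 <= (w ^ (- k))%:E * D k)%E.
  by apply: mule_ge0 => //; rewrite lee_fin ltW.
have t2 k : (0 <= (w ^ (- k))%:E * level_energy f k)%E.
  by apply: mule_ge0; [rewrite lee_fin ltW|exact: level_energy_ge0].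
apply: (@le_lt_trans _ _ (\esum_(k in [set: int])
    (K%:E * ((w ^ (- k))%:E * D k + (w ^ (- k))%:E * level_energy f k)))%E).
  apply: le_esum => k _; rewrite -ge0_muleDr ?level_energy_ge0//.
  rewrite muleCA; apply: lee_wpmul2l; first by rewrite lee_fin ltW.
  exact: level_energy_mul.
rewrite esumZ//; last by move=> k _; exact: adde_ge0.
rewrite esumD//; apply: lte_mul_pinfty; rewrite ?lee_fin ?ltW//.
exact: (lte_add_pinfty dev fs).
Qed.

Lemma haar_energy_le_sobolev_sum f (w : R) Q : 0 < w ->
  (sobolev_sum w f < +oo)%E ->
  haar_energy f Q <= fine (sobolev_sum w f) * w ^ Q.1.
Proof.
move=> w0 fs.
have t k : (0 <= (w ^ (- k))%:E * level_energy f k)%E.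
  by rewrite mule_ge0 ?level_energy_ge0// lee_fin exprz_ge0// ltW.
have s0 : (0 <= sobolev_sum w f)%E by exact: esum_ge0.
rewrite -ler_pdivrMr ?exprz_gt0// mulrC -lee_fin fineK; last by rewrite ge0_fin_numE.
have := @esum_le1 _ _ [set: int]
  (fun k => (w ^ (- k))%:E * level_energy f k)%E Q.1 I (t _).
apply: le_trans; rewrite EFinM invr_expz; apply: lee_wpmul2l.
  by rewrite lee_fin exprz_ge0// ltW.
have := @esum_le1 R _ [set: {ffun 'I_n -> int}]
  (fun m => (haar_energy f (Q.1, m))%:E) Q.2 I.
by rewrite -surjective_pairing; apply; rewrite lee_fin haar_energy_ge0.
Qed.

Lemma dyadic_sobolev_ae_bounded (s : R) f : (0 < n)%N -> n%:R / 2 < s ->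
  dyadic_sobolev n s f ->
  exists2 B, 0 <= B & {ae mu, forall x, `|f x| <= B /\
    mean_at f (- N%:Z) x @[N --> \oo] --> f x}.
Proof.
move=> n0 ns /(dyadic_sobolevP s f n0)[f2 fs].
have w0 : 0 < 2 `^ (2 * s) :> R by rewrite powR_gt0.
apply: (ae_bounded_cvg f2 _ (fun Q => haar_energy_le_sobolev_sum Q w0 fs)).
by rewrite -powR_mulrn//; apply: ltr_powR2; lra.
Qed.

(** Both factors are bounded almost everywhere; truncating them gives factors
that are bounded everywhere in the same classes. *)
Lemma dyadic_sobolev_mul (s : R) f g : (0 < n)%N -> n%:R / 2 < s ->
  dyadic_sobolev n s f -> dyadic_sobolev n s g -> dyadic_sobolev n s (f \* g).
Proof.
move=> n0 ns fs gs.
have [B1 B10 f1] := dyadic_sobolev_ae_bounded n0 ns fs.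
have [B2 B20 g1] := dyadic_sobolev_ae_bounded n0 ns gs.
pose B := B1 + B2 + 1.
have B0 : 0 < B by rewrite /B; lra.
pose clamp u : R := Num.max (- B) (Num.min B u).
have clampB u : `|clamp u| <= B.
  rewrite ler_norml le_max lexx /= ge_max ge_min lexx /= andbT.
  by rewrite -subr_ge0 opprK addr_ge0// ltW.
have clampE u : `|u| <= B -> clamp u = u.
  by rewrite ler_norml => /andP[h1 h2]; rewrite /clamp min_r// max_r.
have mclamp (h : n.-tuple R -> R) :
    measurable_fun setT h -> measurable_fun setT (clamp \o h).
  move=> mh; rewrite (_ : clamp \o h = cst (- B) \max (cst B \min h))//.
  apply: measurable_maxr; first exact: measurable_cst.
  by apply: measurable_minr => //; exact: measurable_cst.
have mS h : dyadic_sobolev n s h -> measurable_fun setT h.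
  by move=> /(dyadic_sobolevP s h n0)[/Lfun2P[]].
have [mf mg] := (mS _ fs, mS _ gs).
have fc : {ae mu, forall x, f x = (clamp \o f) x}.
  apply: filterS f1 => x [fB _]; rewrite /= clampE//.
  by apply: (le_trans fB); rewrite /B; lra.
have gc : {ae mu, forall x, g x = (clamp \o g) x}.
  apply: filterS g1 => x [gB _]; rewrite /= clampE//.
  by apply: (le_trans gB); rewrite /B; lra.
have fs' := dyadic_sobolev_ae n0 (mclamp _ mf) fc fs.
have gs' := dyadic_sobolev_ae n0 (mclamp _ mg) gc gs.
have [B3 _ g3] := dyadic_sobolev_ae_bounded n0 ns gs'.
have aeg : {ae mu, forall x,
    mean_at (clamp \o g) (- N%:Z) x @[N --> \oo] --> (clamp \o g) x}.
  by apply: filterS g3 => x [].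
have := dyadic_sobolev_mul_bounded n0 ns B0 (fun x => clampB (f x))
  (fun x => clampB (g x)) aeg fs' gs'.
apply: dyadic_sobolev_ae => //; first exact: measurable_funM.
by apply: filterS2 fc gc => x /= <- <-.
Qed.

End algebra.

(** * Combinations of the indicators of cubes shrinking to the origin *)

Section corner.
Context {R : realType} {n : nat}.
Implicit Types (Q : dyadic_cube n) (e b : {ffun 'I_n -> bool}).
Implicit Types (x : n.-tuple R) (c : nat -> R).
Local Notation mu := (@lebesgue_tuple R n).

(** The cubes [0, 2^-k)^n. *)
Definition corner (k : nat) : dyadic_cube n := (- k%:Z, [ffun=> 0]).

Definition origin : n.-tuple R := [tuple of nseq n 0].

(** Without the origin every point leaves the sequence of cubes, so that the
sums below are finite everywhere. *)
Definition corner_punctured k : set (n.-tuple R) :=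
  cube_set (corner k) `\ origin.

Lemma cube_set_corner k x : cube_set (corner k) x <->
  forall i, 0 <= tnth x i < 2 ^- k.
Proof.
rewrite /cube_set /corner /Defs.dyadic_itv /=.
split=> h i; have := h i; rewrite ffunE /= in_itv /= mulr0 add0r mulr1;
  by rewrite -exprnN.
Qed.

Lemma corner_anti k l : (k <= l)%N ->
  corner_punctured l `<=` corner_punctured k.
Proof.
move=> kl x [/cube_set_corner h x0]; split => //; apply/cube_set_corner => i.
have /andP[-> h2] := h i; apply: (lt_le_trans h2).
by rewrite lef_pV2 ?posrE ?exprn_gt0// ler_weXn2l// ler1n.
Qed.

Lemma corner_leaves x : exists k, `[< ~ corner_punctured k x >].
Proof.
have [x0|x0] := pselect (x = origin).
  by exists 0%N; apply/asboolP => -[_ /(_ x0)].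
have [i xi] : exists i, tnth x i != 0.
  apply: contrapT => /forallNP h; apply: x0; apply: eq_from_tnth => i.
  by move/negP : (h i); rewrite negbK => /eqP ->; rewrite tnth_nseq.
have /half_expn_lt[N hN] : 0 < `|tnth x i| by rewrite normr_gt0.
exists N; apply/asboolP => -[/cube_set_corner /(_ i) /andP[h1 h2] _].
by move: hN; rewrite ger0_norm// ltNge ltW.
Qed.

(** The number of punctured cubes that contain x, by [ltn_depth]. *)
Definition depth x : nat := ex_minn (corner_leaves x).

Lemma ltn_depth k x : (k < depth x)%N <-> corner_punctured k x.
Proof.
rewrite /depth; case: ex_minnP => d /asboolP dx dmin; split => [kd|kx].
  apply: contrapT => kx; have := dmin k; rewrite leqNgt kd => h.
  by apply: notF; apply: h; apply/asboolP.
rewrite ltnNge; apply/negP => dk; apply: dx; exact: corner_anti kx.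
Qed.

Lemma measurable_origin : measurable [set origin].
Proof.
rewrite (_ : [set origin] =
    \bigcap_(i in [set: 'I_n]) (setT `&`
      (fun x : n.-tuple R => tnth x i) @^-1` [set 0])).
  apply: fin_bigcap_measurable => // i _.
  exact: (@measurable_tnth _ R n i measurableT) (measurable_set1 _).
apply/seteqP; split => [x -> i _ /=|x h].
  by split=> //; rewrite tnth_nseq.
by apply: eq_from_tnth => i; have [_ ->] := h i I; rewrite tnth_nseq.
Qed.

Lemma measurable_corner_punctured k : measurable (corner_punctured k).
Proof.
by apply: measurableD; [exact: measurable_cube|exact: measurable_origin].
Qed.

Lemma lebesgue_origin : (0 < n)%N -> mu [set origin] = 0%E.
Proof.
move=> n0.
rewrite (_ : [set origin] = [set x : n.-tuple R | forall i, [set 0] (tnth x i)]).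
  rewrite (@lebesgue_tuple_box _ _ (fun=> [set 0]))//.
  by rewrite (bigD1 (Ordinal n0))//= lebesgue_measure_set1 mul0e.
apply/seteqP; split => [x -> i /=|x h].
  by rewrite tnth_nseq.
by apply: eq_from_tnth => i; rewrite (h i) tnth_nseq.
Qed.

Lemma lebesgue_corner_punctured k (A : set (n.-tuple R)) : (0 < n)%N ->
  measurable A ->
  mu (corner_punctured k `&` A) = mu (cube_set (corner k) `&` A).
Proof.
move=> n0 mA; apply/eqP; rewrite eq_le; apply/andP; split.
  rewrite le_measure ?inE//.
  - by apply: measurableI => //; exact: measurable_corner_punctured.
  - by apply: measurableI => //; exact: measurable_cube.
  - by move=> x [[Qx _] Ax].
rewrite -(@measureU0 _ _ _ mu (corner_punctured k `&` A) [set origin]).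
- rewrite le_measure ?inE//.
  + by apply: measurableI => //; exact: measurable_cube.
  + apply: measurableU; last exact: measurable_origin.
    by apply: measurableI => //; exact: measurable_corner_punctured.
  + move=> x [Qx Ax]; have [x0|x0] := pselect (x = origin); first by right.
    by left.
- by apply: measurableI => //; exact: measurable_corner_punctured.
- exact: measurable_origin.
- exact: lebesgue_origin.
Qed.

(** The sum of the c k times the indicator of the k-th punctured cube
([chain_nneseries]); written as a partial sum it is visibly real-valued. *)
Definition chain c x : R := \sum_(0 <= k < depth x) c k.

Lemma chain_nneseries c x : (forall k, 0 <= c k) ->
  ((chain c x)%:E = \sum_(k <oo) (c k * \1_(corner_punctured k) x)%:E)%E.
Proof.
move=> c0; rewrite (nneseries_split 0 (depth x)); last first.
  by move=> k _; rewrite lee_fin mulr_ge0.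
rewrite add0n eseries0; last first.
  move=> k dk _; rewrite indicE memNset ?mulr0// => /ltn_depth.
  by rewrite ltnNge dk.
rewrite adde0 sumEFin; congr EFin; rewrite /chain !big_nat.
apply: eq_bigr => k /= kd; rewrite indicE mem_set ?mulr1//.
exact/ltn_depth.
Qed.

Lemma measurable_chain c : (forall k, 0 <= c k) ->
  measurable_fun setT (chain c).
Proof.
move=> c0; apply/measurable_EFinP.
rewrite (_ : _ \o _ = (fun x =>
    \sum_(k <oo) (c k * \1_(corner_punctured k) x)%:E)%E).
  apply: ge0_emeasurable_sum => k x; first by rewrite lee_fin mulr_ge0.
  apply/measurable_EFinP; apply: measurable_funM; first exact: measurable_cst.
  exact: measurable_indic (measurable_corner_punctured _).
by apply/funext => x; exact: chain_nneseries.
Qed.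

Lemma integral_chain c (A : set (n.-tuple R)) : (0 < n)%N ->
  (forall k, 0 <= c k) -> measurable A ->
  (\int[mu]_(x in A) (chain c x)%:E =
   \sum_(k <oo) ((c k)%:E * mu (cube_set (corner k) `&` A)))%E.
Proof.
move=> n0 c0 mA; under eq_integral do rewrite chain_nneseries//.
rewrite integral_nneseries//; last 2 first.
- move=> k; apply/measurable_EFinP; apply: measurable_funM => //.
  apply: measurable_funTS.
  exact: measurable_indic (measurable_corner_punctured _).
- by move=> k x _; rewrite lee_fin mulr_ge0.
apply: eq_eseriesr => k _; under eq_integral do rewrite EFinM.
rewrite ge0_integralZl_EFin//.
- rewrite integral_indic//; last exact: measurable_corner_punctured.
  by congr (_ * _)%E; exact: lebesgue_corner_punctured.
- apply/measurable_EFinP; apply: measurable_funTS.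
  exact: measurable_indic (measurable_corner_punctured _).
Qed.

(** The cubes are nested, so squaring the partial sums of c gives partial sums
of the telescoped squares. *)
Lemma chain_sqr c x : chain c x * chain c x = chain (fun k =>
  (\sum_(0 <= i < k.+1) c i) ^+ 2 - (\sum_(0 <= i < k) c i) ^+ 2) x.
Proof.
rewrite /chain telescope_sumr// big_nil expr0n subr0.
by rewrite expr2.
Qed.

End corner.

(** * Haar coefficients of such combinations *)

Section chain_coefficients.
Context {R : realType} {n : nat}.
Implicit Types (Q : dyadic_cube n) (e b : {ffun 'I_n -> bool}).
Implicit Types (x : n.-tuple R) (c : nat -> R).
Local Notation mu := (@lebesgue_tuple R n).
Local Notation zero_index := ([ffun=> 0] : {ffun 'I_n -> int}).
Local Notation zero_child := ([ffun=> false] : {ffun 'I_n -> bool}).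

Lemma cube_at_origin (k : int) : cube_at k (@origin R n) = (k, zero_index).
Proof.
congr (_, _); apply/ffunP => i; rewrite !ffunE tnth_nseq /dyadic_index mul0r.
exact: floor0.
Qed.

Lemma child_zero Q b : (child Q b).2 = zero_index ->
  Q.2 = zero_index /\ b = zero_child.
Proof.
move=> /ffunP h; split; apply/ffunP => i; have := h i; rewrite !ffunE /=;
  by case: (b i) => /=; lia.
Qed.

(** A corner cube at least as large as Q contains Q or misses it; in both cases
all children contribute equally. *)
Lemma corner_child_coarse k Q b : Q.1 <= - k%:Z ->
  mu (cube_set (corner k) `&` cube_set (child Q b)) =
  (if `[< cube_set Q `<=` (cube_set (corner k) : set (n.-tuple R)) >]
   then cube_volume Q / 2 ^+ n else 0)%:E.
Proof.
move=> le; have sub : cube_set (child Q b) `<=` (cube_set Q : set (n.-tuple R)).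
  by move=> x bx; apply/cube_set_child; exists b.
case: ifPn => [/asboolP QC|/asboolP nQC].
  rewrite setIidr; last exact: subset_trans QC.
  rewrite lebesgue_cube (cube_volume_child Q b) mulrC mulKf//.
rewrite (_ : _ `&` _ = set0) ?measure0//; apply/seteqP; split => // x [Cx bx].
by apply: nQC; exact: (cube_set_nested (sub _ bx) Cx).
Qed.

(** A corner cube smaller than Q lies in a single cube of the level of the
children, the one that contains the origin. *)
Lemma corner_child_fine k Q b : - k%:Z < Q.1 ->
  mu (cube_set (corner k) `&` cube_set (child Q b)) =
  (if (Q.2 == zero_index) && (b == zero_child) then (2 ^+ n) ^- k else 0)%:E.
Proof.
move=> lt; have le : (corner k : dyadic_cube n).1 <= (child Q b).1.
  by rewrite /=; lia.
have oC : cube_set (corner k) (@origin R n).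
  by apply/cube_setP; rewrite cube_at_origin.
case: ifPn => [/andP[/eqP Q0 /eqP b0]|Qb].
  have ob : cube_set (child Q b) (@origin R n).
    apply/cube_setP; rewrite cube_at_origin; congr (_, _).
    by apply/ffunP => i; rewrite !ffunE Q0 b0 !ffunE.
  rewrite setIidl; last exact: (cube_set_nested oC ob le).
  by rewrite lebesgue_cube cube_volumeE /= -exprnN.
rewrite (_ : _ `&` _ = set0) ?measure0//; apply/seteqP; split => // x [Cx bx].
have /cube_setP := cube_set_nested Cx bx le oC.
rewrite cube_at_origin => /(congr1 snd) /= /esym/child_zero[Q0 b0].
by move: Qb; rewrite Q0 b0 !eqxx.
Qed.

(** The integral of the part of the chain made of the corner cubes of level less
than K. *)
Definition chain_tail c (K : int) : \bar R :=
  (\sum_(k <oo | (- k%:Z < K)%R) (c k * (2 ^+ n) ^- k)%:E)%E.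

(** The integral of the chain. *)
Definition chain_mass c : \bar R := (\sum_(k <oo) (c k * (2 ^+ n) ^- k)%:E)%E.

Let term_ge0 c k : (forall k, 0 <= c k) -> 0 <= c k * (2 ^+ n) ^- k.
Proof. by move=> c0; rewrite mulr_ge0// invr_ge0 !exprn_ge0. Qed.

Lemma chain_tail_fin_num c K : (forall k, 0 <= c k) ->
  (chain_mass c < +oo)%E -> chain_tail c K \is a fin_num.
Proof.
move=> c0 coo; rewrite ge0_fin_numE; last first.
  by apply: nneseries_ge0 => k _ _; rewrite lee_fin term_ge0.
apply: le_lt_trans coo; rewrite /chain_tail eseries_mkcond.
apply: lee_nneseries => [k _ _|k _]; case: ifPn => //.
  by rewrite lee_fin term_ge0.
by rewrite lee_fin term_ge0.
Qed.

Lemma integral_chain_mass c : (0 < n)%N -> (forall k, 0 <= c k) ->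
  (\int[mu]_x (chain c x)%:E = chain_mass c)%E.
Proof.
move=> n0 c0; rewrite integral_chain//; apply: eq_eseriesr => k _.
rewrite setIT [X in (_ * X)%E](lebesgue_cube (corner k)) cube_volumeE /=.
by rewrite -exprnN.
Qed.

Lemma chain_ge0 c x : (forall k, 0 <= c k) -> 0 <= chain c x.
Proof. by move=> c0; apply: sumr_ge0. Qed.

Lemma cube_integrable_chain c : (0 < n)%N -> (forall k, 0 <= c k) ->
  (chain_mass c < +oo)%E -> cube_integrable (@chain R n c).
Proof.
move=> n0 c0 coo Q; apply: (@integrableS _ _ _ _ setT) => //.
  exact: measurable_cube.
apply/integrableP; split; first by apply/measurable_EFinP; exact: measurable_chain.
under eq_integral do rewrite /= ger0_norm ?chain_ge0//.
by rewrite integral_chain_mass.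
Qed.

(** The coarse corner cubes contribute A to every child; the fine ones
contribute only to the child at the origin. *)
Lemma chain_child c Q : (0 < n)%N -> (forall k, 0 <= c k) ->
  exists2 A : \bar R, (0 <= A)%E & forall b,
    (\int[mu]_(x in cube_set (child Q b)) (chain c x)%:E =
     A + if (Q.2 == zero_index) && (b == zero_child)
         then chain_tail c Q.1 else 0)%E.
Proof.
move=> n0 c0.
pose a k : R := if - k%:Z < Q.1 then 0 else
  c k * (if `[< cube_set Q `<=` (cube_set (corner k) : set (n.-tuple R)) >]
         then cube_volume Q / 2 ^+ n else 0).
have a0 k : 0 <= a k.
  rewrite /a; case: ifP => // _; rewrite mulr_ge0//; case: ifP => // _.
  by rewrite divr_ge0 ?exprn_ge0// ltW// cube_volume_gt0.
exists (\sum_(k <oo) (a k)%:E)%E.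
  by apply: nneseries_ge0 => k _ _; rewrite lee_fin.
move=> b; rewrite integral_chain//; last exact: measurable_cube.
have -> : (if (Q.2 == zero_index) && (b == zero_child)
    then chain_tail c Q.1 else 0%E) = (\sum_(k <oo) (if (- k%:Z < Q.1)%R then
      c k * (if (Q.2 == zero_index) && (b == zero_child)
        then (2 ^+ n) ^- k else 0) else 0)%:E)%E.
  case: ifPn => _.
    rewrite /chain_tail eseries_mkcond; apply: eq_eseriesr => k _.
    by case: ifPn.
  by rewrite eseries0// => k _ _; rewrite mulr0 if_same.
rewrite -nneseriesD; last 2 first.
- by move=> k _ _; rewrite lee_fin.
- move=> k _ _; rewrite lee_fin; case: ifP => // _; rewrite mulr_ge0//.
  by case: ifP => // _; rewrite invr_ge0 !exprn_ge0.
apply: eq_eseriesr => k _; rewrite /a; case: ifPn => [lt|].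
  rewrite add0e EFinM; congr (_ * _)%E; exact: corner_child_fine.
rewrite -leNgt => le; rewrite adde0 EFinM; congr (_ * _)%E.
exact: corner_child_coarse.
Qed.

(** By [chain_child] and [sum_child_sign] the common contribution of the
children cancels. *)
Lemma inner_chain c Q e : (0 < n)%N -> (forall k, 0 <= c k) ->
  (chain_mass c < +oo)%E -> e <> [ffun=> true] ->
  inner (chain c) (haar Q e) = if Q.2 == zero_index then
    haar_norm Q * (child_sign e zero_child * fine (chain_tail c Q.1)) else 0.
Proof.
move=> n0 c0 coo e1.
have ci := cube_integrable_chain n0 c0 coo.
have [A A0 hA] := chain_child Q n0 c0.
have tfin := chain_tail_fin_num Q.1 c0 coo.
have t0 : (0 <= chain_tail c Q.1)%E.
  by apply: nneseries_ge0 => k _ _; rewrite lee_fin term_ge0.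
have Afin : A \is a fin_num.
  rewrite ge0_fin_numE//.
  have := integrable_fin_num (measurable_cube _) (ci (child Q zero_child)).
  rewrite ge0_fin_numE; last first.
    by apply: integral_ge0 => x _; rewrite lee_fin chain_ge0.
  apply: le_lt_trans; rewrite hA leeDl//; case: ifP => // _.
have cintE b : cube_int (chain c) (child Q b) = fine A +
    (if (Q.2 == zero_index) && (b == zero_child)
     then fine (chain_tail c Q.1) else 0).
  by rewrite /cube_int /Rintegral hA fineD//; case: ifP.
rewrite inner_haar//; under eq_bigr do rewrite cintE mulrDr.
rewrite big_split /= -mulr_suml (sum_child_sign e1) mul0r add0r.
case: ifPn => [_|_] /=; last by rewrite big1 ?mulr0// => b _; rewrite mulr0.
rewrite (bigD1 zero_child)//= eqxx big1 ?addr0// => b /negPf ->.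
by rewrite mulr0.
Qed.

Lemma inner_chain_sqr c Q e : (0 < n)%N -> (forall k, 0 <= c k) ->
  (chain_mass c < +oo)%E -> e <> [ffun=> true] ->
  inner (chain c) (haar Q e) ^+ 2 = if Q.2 == zero_index then
    fine (chain_tail c Q.1) ^+ 2 / (2 ^+ n) ^ Q.1 else 0.
Proof.
move=> n0 c0 coo e1; rewrite inner_chain//; case: ifP => _; last by rewrite expr0n.
by rewrite !exprMn haar_norm_sqr child_sign_sqr mul1r mulrC cube_volumeE.
Qed.

Lemma level_energy_chain_le c K : (0 < n)%N -> (forall k, 0 <= c k) ->
  (chain_mass c < +oo)%E ->
  (level_energy (@chain R n c) K <=
   (2 ^+ n * (fine (chain_tail c K) ^+ 2 / (2 ^+ n) ^ K))%:E)%E.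
Proof.
move=> n0 c0 coo; set t := _ / _.
have t0 : 0 <= t by rewrite divr_ge0 ?sqr_ge0// exprz_ge0// exprn_ge0.
have en m : haar_energy (@chain R n c) (K, m) <=
    if m == zero_index then 2 ^+ n * t else 0.
  rewrite /haar_energy (eq_bigr (fun=> if m == zero_index then t else 0)).
    case: ifP => _; last by rewrite big1.
    rewrite sumr_const -[_ *+ #|_|]mulr_natl ler_wpM2r// -natrX ler_nat.
    by apply: (leq_trans (max_card _)); rewrite card_ffun card_bool card_ord.
  by move=> e /eqP e1; rewrite inner_chain_sqr.
rewrite /level_energy (esumID [set zero_index]); last first.
  by move=> m _; rewrite lee_fin haar_energy_ge0.
rewrite [X in (_ + X)%E]esum1 ?adde0; last first.
  move=> m [_ /eqP m0]; congr EFin; apply/eqP; rewrite eq_le haar_energy_ge0 andbT.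
  by apply: (le_trans (en m)); rewrite (negPf m0).
rewrite setTI esum_set1; last by rewrite lee_fin haar_energy_ge0.
by rewrite lee_fin; apply: (le_trans (en _)); rewrite eqxx.
Qed.

Lemma level_energy_chain_ge c K : (0 < n)%N -> (forall k, 0 <= c k) ->
  (chain_mass c < +oo)%E ->
  ((fine (chain_tail c K) ^+ 2 / (2 ^+ n) ^ K)%:E <=
   level_energy (@chain R n c) K)%E.
Proof.
move=> n0 c0 coo.
have z1 : zero_child != [ffun=> true].
  by apply/eqP => /ffunP/(_ (Ordinal n0)); rewrite !ffunE.
have := @esum_le1 R _ [set: {ffun 'I_n -> int}]
  (fun m => (haar_energy (@chain R n c) (K, m))%:E) zero_index I.
rewrite lee_fin haar_energy_ge0 => /(_ isT); apply: le_trans.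
rewrite lee_fin /haar_energy (bigD1 zero_child)//= inner_chain_sqr//=; last exact/eqP.
by rewrite eqxx lerDl sumr_ge0// => e _; exact: sqr_ge0.
Qed.

End chain_coefficients.

(** * Series used by the counterexample *)

Lemma esum_int (R : realType) (a : int -> \bar R) : (forall k, (0 <= a k)%E) ->
  (\esum_(k in [set: int]) a k =
   \sum_(j <oo) a (- j%:Z)%R + \sum_(j <oo) a j.+1%:Z)%E.
Proof.
move=> a0; rewrite (esumID ((fun j : nat => - j%:Z) @` [set: nat]))// setTI.
rewrite esum_image; last by move=> i j _ _ /oppr_inj [].
have -> : [set: int] `&` ~` ((fun j : nat => - j%:Z) @` [set: nat]) =
    (fun j : nat => j.+1%:Z) @` [set: nat].
  apply/seteqP; split => [[[|j]|j] [_ h]|k [j _ <-]].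
  - by exfalso; apply: h; exists 0%N.
  - by exists j.
  - by exfalso; apply: h; exists j.+1.
  - by split=> // -[i _]; lia.
rewrite esum_image; last by move=> i j _ _ [].
by rewrite !nneseries_esumT.
Qed.

Lemma nneseries_le (R : realType) (a : nat -> R) (P : pred nat) (M : R) :
  (forall k, 0 <= a k) -> (forall N, \sum_(0 <= k < N | P k) a k <= M) ->
  (\sum_(k <oo | P k) (a k)%:E <= M%:E)%E.
Proof.
move=> a0 aM; apply: lime_le.
  by apply: is_cvg_nneseries_cond => k _ _; rewrite lee_fin.
by apply: nearW => N; rewrite sumEFin lee_fin.
Qed.

Lemma geometric_tail_le (R : realFieldType) (r : R) (j N : nat) :
  0 <= r < 1 -> \sum_(0 <= k < N | (j < k)%N) r ^+ k <= r ^+ j / (1 - r).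
Proof.
move=> /andP[r0 r1]; have r1' : 0 < 1 - r by rewrite subr_gt0.
apply: (@le_trans _ _ ((r ^+ j - r ^+ maxn j N) / (1 - r))); last first.
  by rewrite ler_pM2r ?invr_gt0// gerBl exprn_ge0.
elim: N => [|N IH]; first by rewrite big_nil maxn0 subrr mul0r.
rewrite big_mkcond big_nat_recr//= -big_mkcond /=; case: ifPn => jN.
  rewrite (maxn_idPr (ltnW jN)) in IH; rewrite (maxn_idPr (leqW (ltnW jN))).
  apply: (le_trans (lerD IH (lexx _))).
  rewrite le_eqVlt; apply/orP; left; apply/eqP; rewrite exprS.
  by field; rewrite gt_eqF.
rewrite addr0; apply: (le_trans IH); rewrite ler_pM2r ?invr_gt0// lerD2l lerN2.
apply: ler_wiXn2l => //; first exact: ltW.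
by rewrite geq_max leq_maxl (leq_trans (leqnSn N))// leq_maxr.
Qed.

Section sequence.
Context {R : realType}.

Definition sqrt_succ (k : nat) : R := Num.sqrt k.+1%:R.

Lemma sqrt_succ_sqr k : sqrt_succ k ^+ 2 = k.+1%:R.
Proof. by rewrite /sqrt_succ sqr_sqrtr. Qed.

Lemma sqrt_succ_gt0 k : 0 < sqrt_succ k.
Proof. by rewrite sqrtr_gt0 ltr0n. Qed.

Lemma sqrt_succ_ge1 k : 1 <= sqrt_succ k.
Proof. by rewrite -[leLHS]sqrtr1 ler_wsqrtr// ler1n. Qed.

Lemma sqrt_succ_mono k l : (k <= l)%N -> sqrt_succ k <= sqrt_succ l.
Proof. by move=> kl; rewrite ler_wsqrtr// ler_nat. Qed.

(** Comparison with the telescoping sequence 2 / (k+1)^(1/2). *)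
Lemma sum_sqrt_succ3 N : \sum_(0 <= k < N) sqrt_succ k ^- 3 <= 3.
Proof.
case: N => [|N]; first by rewrite big_nil.
suff h : \sum_(0 <= k < N.+1) sqrt_succ k ^- 3 <= 3 - 2 / sqrt_succ N.
  by apply: (le_trans h); rewrite gerBl divr_ge0// ltW// sqrt_succ_gt0.
elim: N => [|N IH].
  rewrite big_nat1; have -> : sqrt_succ 0 = 1 by rewrite /sqrt_succ sqrtr1.
  by rewrite expr1n invr1; lra.
rewrite big_nat_recr//=; apply: (le_trans (lerD IH (lexx _))).
have a0 := sqrt_succ_gt0 N; have b0 := sqrt_succ_gt0 N.+1.
have ab := sqrt_succ_mono (leqnSn N).
have e : sqrt_succ N.+1 ^+ 2 = sqrt_succ N ^+ 2 + 1 by rewrite !sqrt_succ_sqr -natr1.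
set a := sqrt_succ N in a0 ab e *; set b := sqrt_succ N.+1 in b0 ab e *.
have -> : 3 - 2 / b = 3 - 2 / a + 2 * (b ^+ 2 - a ^+ 2) / (a * b * (a + b)).
  by field; rewrite !gt_eqF// addr_gt0.
rewrite lerD2l e addrAC subrr add0r mulr1.
rewrite ler_pdivlMr ?mulr_gt0 ?addr_gt0//.
rewrite -[b ^- 3]div1r mulrAC mul1r ler_pdivrMr ?exprn_gt0//.
have : a * b * (a + b) <= b * b * (b + b).
  by rewrite ler_pM ?mulr_ge0 ?addr_ge0 ?lerD// ?ler_wpM2r// ltW.
nra.
Qed.

(** The sequence (k+1)^(-3/4): its squares are summable, whereas the squares of
(k+1) slow(k)^2 are not. *)
Definition slow (k : nat) : R := Num.sqrt (sqrt_succ k ^- 3).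

Lemma slow_sqr k : slow k ^+ 2 = sqrt_succ k ^- 3.
Proof. by rewrite /slow sqr_sqrtr// invr_ge0 exprn_ge0// ltW// sqrt_succ_gt0. Qed.

Lemma slow_ge0 k : 0 <= slow k. Proof. exact: sqrtr_ge0. Qed.

Lemma slow_anti k l : (k <= l)%N -> slow l <= slow k.
Proof.
move=> kl; rewrite /slow ler_wsqrtr// lef_pV2 ?posrE ?exprn_gt0 ?sqrt_succ_gt0//.
by rewrite ler_pXn2r ?nnegrE ?sqrt_succ_mono// ltW// sqrt_succ_gt0.
Qed.

Lemma slow_le1 k : slow k <= 1.
Proof.
rewrite -[leRHS]sqrtr1 ler_wsqrtr// invf_le1 ?exprn_gt0 ?sqrt_succ_gt0//.
by rewrite exprn_ege1// sqrt_succ_ge1.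
Qed.

Lemma slow_sqr_mul k : slow k ^+ 2 * k.+1%:R = (sqrt_succ k)^-1.
Proof.
rewrite slow_sqr -sqrt_succ_sqr; field; by rewrite gt_eqF// sqrt_succ_gt0.
Qed.

End sequence.

(** * The counterexample for s <= n/2 *)

Section counterexample.
Context {R : realType} {n : nat}.
Variable w : R.
Hypothesis n0 : (0 < n)%N.
Hypothesis w1 : 1 < w.
Hypothesis wv : w <= 2 ^+ n.
Local Notation mu := (@lebesgue_tuple R n).
Local Notation v := ((2 : R) ^+ n).

Let v0 : 0 < v. Proof. by rewrite exprn_gt0. Qed.

Let w0 : 0 < w. Proof. exact: lt_trans w1. Qed.

(** At s = n/2 the growth factor is 1 and only the slowly varying factor is
left. *)
Definition growth : R := Num.sqrt (v / w).

(** The ratio in spike(k) v^(-k) = slow(k) decay^k. *)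
Definition decay : R := growth / v.

Definition spike (k : nat) : R := growth ^+ k * slow k.

(** The coefficients of the square of the chain, by [chain_sqr]. *)
Definition spike_sqr (k : nat) : R :=
  (\sum_(0 <= i < k.+1) spike i) ^+ 2 - (\sum_(0 <= i < k) spike i) ^+ 2.

Let growth_sqr : growth ^+ 2 = v / w.
Proof. by rewrite /growth sqr_sqrtr// divr_ge0// ltW. Qed.

Let growth_ge1 : 1 <= growth.
Proof.
by rewrite -[leLHS]sqrtr1 ler_wsqrtr// ler_pdivlMr// mul1r.
Qed.

Let growth_gt0 : 0 < growth.
Proof. exact: lt_le_trans growth_ge1. Qed.

Let decay_gt0 : 0 < decay. Proof. by rewrite divr_gt0. Qed.

Let decay_sqr : decay ^+ 2 = (w * v)^-1.
Proof.
by rewrite /decay expr_div_n growth_sqr; field; rewrite !gt_eqF.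
Qed.

Let decay_lt1 : decay < 1.
Proof.
rewrite -(ltr_pXn2r (ltn0Sn 1)) ?nnegrE ?ltW// decay_sqr expr1n.
rewrite invf_lt1 ?mulr_gt0//; apply: (lt_le_trans w1); apply: ler_peMr.
  exact: ltW.
by apply: exprn_ege1; rewrite ler1n.
Qed.

Let spike_ge0 k : 0 <= spike k.
Proof. by rewrite mulr_ge0 ?slow_ge0// exprn_ge0// ltW. Qed.

Let spike_decay k : spike k * v ^- k = slow k * decay ^+ k.
Proof. by rewrite /spike /decay expr_div_n; ring. Qed.

Let tail_sum_le j N :
  \sum_(0 <= k < N | (j < k)%N) spike k * v ^- k <=
  slow j * (decay ^+ j / (1 - decay)).
Proof.
have d01 : 0 <= decay < 1 by rewrite ltW//=.
apply: le_trans (ler_wpM2l (slow_ge0 j) (geometric_tail_le j N d01)).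
rewrite mulr_sumr; apply: ler_sum => k jk; rewrite spike_decay.
by apply: ler_wpM2r; [exact: exprn_ge0 (ltW decay_gt0)|exact: slow_anti (ltnW jk)].
Qed.

Let term_ge0 k : 0 <= spike k * v ^- k.
Proof. by rewrite spike_decay mulr_ge0 ?slow_ge0// exprn_ge0// ltW. Qed.

Lemma spike_mass_lty : (@chain_mass R n spike < +oo)%E.
Proof.
have d01 : 0 <= decay < 1 by rewrite ltW//=.
apply: le_lt_trans (geometric_nneseries_lty (ler01 : 0 <= 1 :> R) d01).
apply: lee_nneseries => [k _ _|k _]; rewrite lee_fin ?term_ge0//.
by rewrite spike_decay; apply: ler_wpM2r (slow_le1 k); rewrite exprn_ge0// ltW.
Qed.

(** The factor slow is decreasing, so it can be taken out of the tail, which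
is then geometric. *)
Lemma spike_tail_le j :
  fine (@chain_tail R n spike (- j%:Z)) <= slow j * (decay ^+ j / (1 - decay)).
Proof.
rewrite -lee_fin fineK; last exact: chain_tail_fin_num spike_mass_lty.
rewrite /chain_tail.
rewrite (eq_eseriesl (Q := fun k => (j < k)%N)); last first.
  by move=> k; rewrite ltrN2 ltz_nat.
by apply: nneseries_le; [exact: term_ge0|exact: tail_sum_le].
Qed.

Let tail_ge0 c K : (forall k, 0 <= c k) ->
  0 <= fine (@chain_tail R n c K).
Proof.
move=> c0; apply: fine_ge0; apply: nneseries_ge0 => k _ _.
by rewrite lee_fin mulr_ge0// invr_ge0 !exprn_ge0.
Qed.

(** On the cube of level -j the weighted energy is O(slow(j)^2), because the
square of the decay is 1 / (w v). On the large cubes the tail is the full mass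
and the weights give a geometric series. *)
Lemma sobolev_sum_spike_lty : (sobolev_sum w (@chain R n spike) < +oo)%E.
Proof.
pose t K := fine (@chain_tail R n spike K).
have t0 K : 0 <= t K by exact: tail_ge0.
pose b K := w ^ (- K) * (v * (t K ^+ 2 / v ^ K)).
have wk K : 0 < w ^ K by rewrite exprz_gt0.
have vk K : 0 < v ^ K by rewrite exprz_gt0.
have b0 K : 0 <= b K.
  apply: (mulr_ge0 (ltW (wk _))); apply: (mulr_ge0 (ltW v0)).
  exact: divr_ge0 (sqr_ge0 _) (ltW (vk _)).
apply: (@le_lt_trans _ _ (\esum_(K in [set: int]) (b K)%:E)%E).
  apply: le_esum => K _; rewrite /b EFinM; apply: lee_wpmul2l.
    by rewrite lee_fin ltW.
  exact: level_energy_chain_le spike_mass_lty.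
rewrite esum_int; last by move=> K; rewrite lee_fin.
have d1 : 0 < 1 - decay by rewrite subr_gt0.
apply: lte_add_pinfty.
  apply: (@le_lt_trans _ _ (v / (1 - decay) ^+ 2 * 3)%:E); last exact: ltry.
  apply: nneseries_le => // N.
  apply: le_trans (ler_wpM2l _ (sum_sqrt_succ3 N)); last first.
    by rewrite divr_ge0 ?sqr_ge0// ltW.
  rewrite mulr_sumr; apply: ler_sum => j _; rewrite -slow_sqr.
  have le2 : t (- j%:Z) ^+ 2 <= slow j ^+ 2 * ((w * v) ^- j / (1 - decay) ^+ 2).
    have -> : slow j ^+ 2 * ((w * v) ^- j / (1 - decay) ^+ 2) =
        (slow j * (decay ^+ j / (1 - decay))) ^+ 2.
      have dj : (decay ^+ j) ^+ 2 = (w * v) ^- j.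
        by rewrite -exprM mulnC exprM decay_sqr exprVn.
      by rewrite -dj; field; rewrite gt_eqF.
    rewrite ler_pXn2r ?nnegrE ?t0//; first exact: spike_tail_le.
    by rewrite mulr_ge0 ?slow_ge0// divr_ge0 ?exprn_ge0// ltW.
  rewrite /b opprK -exprnN invrK.
  apply: (@le_trans _ _ (w ^ j * (v * (slow j ^+ 2 *
     ((w * v) ^- j / (1 - decay) ^+ 2) * v ^+ j)))).
    apply: ler_wpM2l; first exact: ltW.
    apply: ler_wpM2l; first exact: ltW.
    by rewrite ler_wpM2r// exprn_ge0// ltW.
  rewrite -exprnP exprMn le_eqVlt; apply/orP; left; apply/eqP; field.
  by rewrite !gt_eqF ?exprn_gt0.
pose T := fine (@chain_mass R n spike).
have mfin : @chain_mass R n spike \is a fin_num.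
  rewrite ge0_fin_numE ?spike_mass_lty//.
  by apply: nneseries_ge0 => k _ _; rewrite lee_fin term_ge0.
have tT K : t K <= T.
  rewrite -lee_fin !fineK//; last exact: chain_tail_fin_num spike_mass_lty.
  rewrite /chain_tail eseries_mkcond; apply: lee_nneseries => [k _ _|k _].
    by case: ifP => _; rewrite lee_fin ?term_ge0.
  by case: ifP => _; rewrite lee_fin ?term_ge0.
have d201 : 0 <= (w * v)^-1 < 1.
  by rewrite -decay_sqr sqr_ge0 /= expr_lt1// ltW.
have C0 : 0 <= v * T ^+ 2 / (w * v).
  by apply: divr_ge0; apply: mulr_ge0; rewrite ?sqr_ge0 ?ltW.
apply: le_lt_trans (geometric_nneseries_lty C0 d201).
apply: lee_nneseries => [k _ _|j _]; rewrite lee_fin ?b0//.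
have t2 : t j.+1 ^+ 2 <= T ^+ 2.
  by rewrite ler_pXn2r ?nnegrE ?tT//; exact: le_trans (t0 j.+1) (tT _).
rewrite /b -exprnN -exprnP.
apply: (@le_trans _ _ (w ^- j.+1 * (v * (T ^+ 2 / v ^+ j.+1)))).
  apply: ler_wpM2l; first by rewrite invr_ge0 exprn_ge0// ltW.
  apply: ler_wpM2l; first exact: ltW.
  by rewrite ler_wpM2r// invr_ge0 exprn_ge0// ltW.
rewrite exprVn exprMn !exprS le_eqVlt; apply/orP; left; apply/eqP; field.
by rewrite !gt_eqF ?exprn_gt0.
Qed.

Let partial_ge0 k : 0 <= \sum_(0 <= i < k) spike i.
Proof. by apply: sumr_ge0 => i _. Qed.

Let spike_sqrE k : spike_sqr k =
  spike k * (\sum_(0 <= i < k.+1) spike i + \sum_(0 <= i < k) spike i).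
Proof. by rewrite /spike_sqr big_nat_recr//=; ring. Qed.

Let spike_sqr_ge0 k : 0 <= spike_sqr k.
Proof. by rewrite spike_sqrE mulr_ge0// addr_ge0. Qed.

Let partial_le k : \sum_(0 <= i < k.+1) spike i <= k.+1%:R * growth ^+ k.
Proof.
apply: (@le_trans _ _ (\sum_(0 <= i < k.+1) growth ^+ k)).
  rewrite !big_nat; apply: ler_sum => i /= ik.
  apply: (@le_trans _ _ (growth ^+ i)).
    by rewrite /spike ler_piMr ?slow_le1// exprn_ge0// ltW.
  by rewrite ler_weXn2l.
by rewrite big_const_nat iter_addr_0 subn0 mulr_natl.
Qed.

Let partial_ge k : k.+1%:R * slow k <= \sum_(0 <= i < k.+1) spike i.
Proof.
apply: (@le_trans _ _ (\sum_(0 <= i < k.+1) slow k)).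
  by rewrite big_const_nat iter_addr_0 subn0 mulr_natl.
rewrite !big_nat; apply: ler_sum => i /= ik.
rewrite /spike; apply: (@le_trans _ _ (slow i)); first by rewrite slow_anti.
by rewrite ler_peMl ?slow_ge0// exprn_ege1.
Qed.

(** The coefficients are at most 2 (k+1) (v/w)^k, since the partial sums of
spike are at most (k+1) growth^k. So the series is dominated by (k+1) w^(-k), and
the factor k+1 is absorbed by th^k with 1 < th < w. *)
Lemma spike_sqr_mass_lty : (@chain_mass R n spike_sqr < +oo)%E.
Proof.
pose th := (1 + w) / 2.
have th1 : 1 < th by have := w1; rewrite /th; lra.
have thw : th < w by have := w1; rewrite /th; lra.
have th0 : 0 < th - 1 by rewrite subr_gt0.
have th00 : 0 < th by exact: lt_trans th1.
(* Bernoulli's inequality for th^k. *)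
have bern k : k.+1%:R <= (1 + (th - 1)^-1) * th ^+ k.
  have h : 1 + k%:R * (th - 1) <= th ^+ k.
    elim: k => [|k IH]; first by rewrite mul0r addr0 expr0.
    have k0 : 0 <= k%:R :> R by [].
    have := ler_wpM2l (ltW th00) IH.
    have : 0 <= k%:R * (th - 1) ^+ 2 by rewrite mulr_ge0// sqr_ge0.
    rewrite [th ^+ k.+1]exprS -natr1; lra.
  have h1 : 1 <= th ^+ k by rewrite exprn_ege1// ltW.
  rewrite mulrDl mul1r -natr1 [leRHS]addrC lerD// ler_pdivlMl//.
  by rewrite mulrC; lra.
have r01 : 0 <= th / w < 1.
  by rewrite (divr_ge0 (ltW th00) (ltW w0)) ltr_pdivrMr// mul1r.
have C0 : 0 <= 2 * (1 + (th - 1)^-1).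
  by rewrite mulr_ge0// addr_ge0// invr_ge0 ltW.
apply: le_lt_trans (geometric_nneseries_lty C0 r01).
apply: lee_nneseries => [k _ _|k _]; rewrite lee_fin.
  by rewrite mulr_ge0 ?spike_sqr_ge0// invr_ge0 exprn_ge0// ltW.
have g0 : 0 <= growth ^+ k by rewrite exprn_ge0// ltW.
have sk : spike k <= growth ^+ k by rewrite /spike ler_piMr ?slow_le1.
have S1 := partial_le k.
have S2 : \sum_(0 <= i < k) spike i <= \sum_(0 <= i < k.+1) spike i.
  by rewrite big_nat_recr//= lerDl.
have le1 : spike_sqr k <= 2 * k.+1%:R * (growth ^+ 2) ^+ k.
  rewrite spike_sqrE -exprM mulnC exprM.
  have -> : 2 * k.+1%:R * (growth ^+ k) ^+ 2 =
    growth ^+ k * (k.+1%:R * growth ^+ k + k.+1%:R * growth ^+ k) by ring.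
  by rewrite ler_pM ?addr_ge0// lerD// (le_trans S2).
rewrite ler_pdivrMr ?exprn_gt0//; apply: (le_trans le1).
have -> : 2 * (1 + (th - 1)^-1) * (th / w) ^+ k * v ^+ k =
    2 * ((1 + (th - 1)^-1) * th ^+ k) * (growth ^+ 2) ^+ k.
  by rewrite growth_sqr !expr_div_n; ring.
apply: ler_wpM2r; first by rewrite exprn_ge0// sqr_ge0.
by apply: ler_wpM2l.
Qed.

(** The k-th coefficient is at least spike(k) times the partial sum up to k,
and that partial sum is at least (k+1) slow(k) because growth >= 1. *)
Lemma spike_sqr_ge k : growth ^+ k / sqrt_succ k <= spike_sqr k.
Proof.
rewrite -slow_sqr_mul spike_sqrE.
have -> : growth ^+ k * (slow k ^+ 2 * k.+1%:R) = spike k * (k.+1%:R * slow k).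
  by rewrite /spike; ring.
apply: ler_wpM2l => //; apply: (le_trans (partial_ge k)).
by rewrite lerDl.
Qed.

(** The tail at level -j is at least its first term, of index j+1; its weighted
square is at least (w v)^-1 / (j+2) by [spike_sqr_ge], and the harmonic series
diverges. *)
Lemma sobolev_sum_spike_sqr :
  ~ (sobolev_sum w (@chain R n spike_sqr) < +oo)%E.
Proof.
move=> fin; pose t K := fine (@chain_tail R n spike_sqr K).
have t0 K : 0 <= t K by exact: tail_ge0.
have tj j : spike_sqr j.+1 * v ^- j.+1 <= t (- j%:Z).
  rewrite -lee_fin fineK; last exact: chain_tail_fin_num spike_sqr_mass_lty.
  rewrite /chain_tail eseries_mkcond.
  apply: le_trans (nneseries_lim_ge j.+2 _); last first.
    move=> k _ _; case: ifP => // _.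
    by rewrite lee_fin mulr_ge0// invr_ge0 exprn_ge0// ltW.
  rewrite big_nat_recr//= ltrN2 ltz_nat ltnSn leeDr//.
  apply: sume_ge0 => k _; case: ifP => // _.
  by rewrite lee_fin mulr_ge0// invr_ge0 exprn_ge0// ltW.
have term j : (((w * v)^-1 / j.+2%:R)%:E <=
    (w ^ (- - j%:Z))%:E * level_energy (@chain R n spike_sqr) (- j%:Z))%E.
  rewrite opprK -exprnP.
  apply: le_trans (lee_wpmul2l _ (level_energy_chain_ge (- j%:Z) n0 spike_sqr_ge0
    spike_sqr_mass_lty)); last by rewrite lee_fin exprn_ge0// ltW.
  rewrite -EFinM lee_fin -exprnN invrK -/(t _).
  have h : (growth ^+ j.+1 / sqrt_succ j.+1 * v ^- j.+1) ^+ 2 <= t (- j%:Z) ^+ 2.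
    have g0 : 0 <= growth ^+ j.+1 / sqrt_succ j.+1 * v ^- j.+1.
      by rewrite mulr_ge0 ?divr_ge0 ?invr_ge0 ?exprn_ge0// ltW// sqrt_succ_gt0.
    rewrite ler_pXn2r ?nnegrE//; apply: le_trans (tj j).
    by rewrite ler_wpM2r ?spike_sqr_ge// invr_ge0 exprn_ge0// ltW.
  apply: le_trans (ler_wpM2l (exprn_ge0 _ (ltW w0))
    (ler_wpM2r (exprn_ge0 _ (ltW v0)) h)).
  have -> : (growth ^+ j.+1 / sqrt_succ j.+1 * v ^- j.+1) ^+ 2 =
      (v / w) ^+ j.+1 / j.+2%:R * (v ^- j.+1) ^+ 2.
    have gj : (growth ^+ j.+1) ^+ 2 = (v / w) ^+ j.+1.
      by rewrite -exprM mulnC exprM growth_sqr.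
    rewrite -gj -(sqrt_succ_sqr j.+1); field.
    by rewrite !gt_eqF ?exprn_gt0 ?sqrt_succ_gt0.
  rewrite expr_div_n !exprS le_eqVlt; apply/orP; left; apply/eqP; field.
  by rewrite !gt_eqF ?exprn_gt0 ?ltr0n.
pose C := (w * v)^-1; have C0 : 0 < C by rewrite invr_gt0 mulr_gt0.
have a0 j : 0 <= C / j.+2%:R by rewrite divr_ge0// ltW.
have sumfin : (\sum_(j <oo) (C / j.+2%:R)%:E < +oo)%E.
  apply: le_lt_trans fin; rewrite /sobolev_sum esum_int; last first.
    move=> K; apply: mule_ge0 (level_energy_ge0 _ _).
    by rewrite lee_fin exprz_ge0// ltW.
  apply: (@le_trans _ _ (\sum_(j <oo)
    (w ^ (- - j%:Z))%:E * level_energy (@chain R n spike_sqr) (- j%:Z)))%E.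
    by apply: lee_nneseries => // j _ _; rewrite lee_fin.
  rewrite leeDl//; apply: nneseries_ge0 => j _ _.
  apply: mule_ge0 (level_energy_ge0 _ _).
  by rewrite lee_fin exprz_ge0// ltW.
apply: (@dvg_harmonic R).
apply: nondecreasing_is_cvgn.
  by apply/nondecreasing_series => k _ _; exact: harmonic_ge0.
exists (1 + fine (\sum_(j <oo) (C / j.+2%:R)%:E)%E / C) => _ [N _ <-].
have part M : \sum_(0 <= j < M) C / j.+2%:R <= fine (\sum_(j <oo) (C / j.+2%:R)%:E)%E.
  rewrite -lee_fin fineK; last first.
    by rewrite ge0_fin_numE//; apply: nneseries_ge0 => j _ _; rewrite lee_fin.
  rewrite -sumEFin; apply: nneseries_lim_ge => j _ _; rewrite lee_fin//.
case: N => [|N].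
  rewrite /series /= big_nil; apply: addr_ge0 => //; apply: divr_ge0 (ltW C0).
  by have := part 0%N; rewrite big_nil.
rewrite /series /= big_nat_recl//= invr1 lerD2l ler_pdivlMr// mulrC mulr_sumr.
exact: part.
Qed.

End counterexample.

(** * The characterisation *)

Lemma spike_chain_sqr (R : realType) (n : nat) (w : R) (x : n.-tuple R) :
  chain (spike (n := n) w) x * chain (spike (n := n) w) x =
  chain (spike_sqr (n := n) w) x.
Proof. exact: chain_sqr. Qed.

Lemma dyadic_sobolev_not_algebra (R : realType) (n : nat) (s : R) :
  (0 < n)%N -> 0 < s -> s <= n%:R / 2 ->
  exists2 f : n.-tuple R -> R, dyadic_sobolev n s f &
    ~ dyadic_sobolev n s (f \* f).
Proof.
move=> n0 s0 sn; pose w : R := 2 `^ (2 * s).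
have w1 : 1 < w by rewrite -(powRr0 2); apply: ltr_powR2; lra.
have wv : w <= 2 ^+ n by rewrite -powR_mulrn//; apply: ler_powR; [rewrite ler1n|lra].
have c0 k : 0 <= spike (n := n) w k.
  by rewrite mulr_ge0 ?slow_ge0// exprn_ge0// sqrtr_ge0.
have d0 k : 0 <= spike_sqr (n := n) w k.
  rewrite /spike_sqr subr_ge0 ler_pXn2r ?nnegrE ?sumr_ge0//.
  by rewrite big_nat_recr//= lerDl.
exists (chain (spike (n := n) w)); apply/dyadic_sobolevP => //.
  split; last exact: sobolev_sum_spike_lty.
  apply/Lfun2P; split; first exact: measurable_chain.
  under eq_integral do rewrite expr2 spike_chain_sqr.
  rewrite integral_chain_mass//; exact: spike_sqr_mass_lty.
move=> [_]; rewrite (_ : _ \* _ = chain (spike_sqr (n := n) w)).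
  exact: sobolev_sum_spike_sqr.
by apply/funext => x; exact: spike_chain_sqr.
Qed.

Theorem mainTheorem2 (R : realType) (n : nat) (s : R)
    (hn : (1 <= n)%N) (hs0 : 0 < s) (hsn : s < n%:R) :
  (forall f g : n.-tuple R -> R,
      dyadic_sobolev n s f -> dyadic_sobolev n s g ->
      dyadic_sobolev n s (f \* g)) <->
  n%:R / 2 < s.
Proof.
split=> [alg|ns f g]; last exact: dyadic_sobolev_mul.
rewrite ltNge; apply/negP => sn.
have [f fs] := dyadic_sobolev_not_algebra hn hs0 sn.
by apply; exact: alg.
Qed.
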